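(* Assume $0$ belongs to a nonlinearity interval. Let $\mu>0$, let $(X^\mu,y^\mu,S^\mu)$ be the central solution at $\epsilon=0$, and let $\epsilon$ belong to this nonlinearity interval, in a neighborhood of $0$. If $\mu<\min\{\tilde\mu,\tilde\mu(\epsilon)\}$ and $$|\epsilon|<\frac1{\theta^\mu\|\bar C\|}\min\Big\{\frac{\delta^\mu}2,\ \frac1{2\theta^\mu},\ \frac{\lambda_{[n_{\mathcal B}]}(X^\mu)-\lambda_{[n_{\mathcal B}+1]}(X^\mu)}{10},\ \frac{\lambda_{[n_{\mathcal N}]}(S^\mu)-\lambda_{[n_{\mathcal N}+1]}(S^\mu)}{10}\Big\},$$ then there exists a central solution $(X^\mu(\epsilon),y^\mu(\epsilon),S^\mu(\epsilon))$ at $\epsilon$ such that $$\operatorname{dist}\big(\mathcal R(Q^\mu_{\mathcal B}),\mathcal R(Q^\mu_{\mathcal B(\epsilon)})\big)\le\frac{4\big(1-\sqrt{1-2|\epsilon|(\theta^\mu)^2\|\bar C\|}\big)}{\theta^\mu\big(\lambda_{[n_{\mathcal B}]}(X^\mu)-\lambda_{[n_{\mathcal B}+1]}(X^\mu)\big)},$$ $$\operatorname{dist}\big(\mathcal R(Q^\mu_{\mathcal N}),\mathcal R(Q^\mu_{\mathcal N(\epsilon)})\big)\le\frac{4\big(1-\sqrt{1-2|\epsilon|(\theta^\mu)^2\|\bar C\|}\big)}{\theta^\mu\big(\lambda_{[n_{\mathcal N}]}(S^\mu)-\lambda_{[n_{\mathcal N}+1]}(S^\mu)\big)}.$$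
   Context: Setting. $\mathbb S^n$ is the space of real symmetric $n\times n$ matrices with inner product $\langle C,X\rangle=\operatorname{trace}(CX)$; $\mathbb S^n_+$ is the cone of positive semidefinite matrices; $X\succeq0$ ($\succ0$) means positive semidefinite (definite). Given $C,\bar C,A^1,\dots,A^m\in\mathbb S^n$ and $b\in\mathbb R^m$, consider for $\epsilon\in\mathbb R$ $$(\mathrm P_\epsilon)\ \min\{\langle C+\epsilon\bar C,X\rangle : \langle A^i,X\rangle=b_i,\ i=1,\dots,m,\ X\succeq0\},$$ $$(\mathrm D_\epsilon)\ \max\{b^Ty : \textstyle\sum_i y_iA^i+S=C+\epsilon\bar C,\ S\succeq0,\ y\in\mathbb R^m\}.$$ Standing assumptions: $A^1,\dots,A^m$ are linearly independent, and at $\epsilon=0$ there is a feasible $(X,y,S)$ of $(\mathrm P_0),(\mathrm D_0)$ with $X\succ0$, $S\succ0$. $v(\epsilon)$ is the optimal value of $(\mathrm P_\epsilon)$ and $\mathcal E=\{\epsilon: v(\epsilon)>-\infty\}$, a closed interval with $0$ in its interior. For $\epsilon\in\operatorname{int}(\mathcal E)$ strong duality holds and the sets of optimal solutions $\mathcal P^*(\epsilon)$ (of $X$) and $\mathcal D^*(\epsilon)$ (of $(y,S)$) are nonempty and compact. An optimal solution $(X,y,S)$ is maximally complementary if $X\in\operatorname{ri}(\mathcal P^*(\epsilon))$ and $(y,S)\in\operatorname{ri}(\mathcal D^*(\epsilon))$. Optimal partition: for a maximally complementary solution $(X^*(\epsilon),y^*(\epsilon),S^*(\epsilon))$, $\mathcal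 B(\epsilon)$ is the column space of $X^*(\epsilon)$, $\mathcal N(\epsilon)$ the column space of $S^*(\epsilon)$, $\mathcal T(\epsilon)=(\mathcal B(\epsilon)+\mathcal N(\epsilon))^\perp$, $\pi(\epsilon)=(\mathcal B(\epsilon),\mathcal T(\epsilon),\mathcal N(\epsilon))$. A nonlinearity interval is a non-singleton open, possibly unbounded, subinterval of $\operatorname{int}(\mathcal E)$ of maximal length on which $\dim\mathcal B(\epsilon)$ and $\dim\mathcal N(\epsilon)$ are constant while $\pi(\epsilon)$ varies with $\epsilon$ (is not constant). The argument $\epsilon$ is dropped when $\epsilon=0$; $n_{\mathcal B},n_{\mathcal T},n_{\mathcal N}$ are the dimensions of $\mathcal B,\mathcal T,\mathcal N$ (the same for all $\epsilon$ in the nonlinearity interval containing $0$, and there $1\le n_{\mathcal B},n_{\mathcal N}\le n-1$). Notation: $\lambda_{[i]}(X)$ is the $i$-th largest eigenvalue; $\|\cdot\|$ is the Frobenius norm; $\|\cdot\|_2$ the Euclidean/spectral norm; $\mathcal R(\cdot)$ the column space; for subspaces of equal dimension $\operatorname{dist}(\mathcal S_1,\mathcal S_2)=\|\mathrm{Proj}_{\mathcal S_1}-\mathrm{Proj}_{\mathcal S_2}\|_2$ with orthogonal projections. $\operatorname{svec}:\mathbb S^n\to\mathbb R^{n(n+1)/2}$ stacks the upper triangle with off-diagonal entries multiplied by $\sqrt2$; $\mathcal A=(\operatorname{svec}(A^1),\dots,\operatorname{svec}(A^m))^T$. Central solutions: for $\mu>0$, a central solution $(X^\mu(\epsilon),y^\mu(\epsilon),S^\mu(\epsilon))$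 is a (necessarily unique) solution of $\langle A^i,X\rangle=b_i$ ($i=1,\dots,m$), $\sum_iy_iA^i+S=C+\epsilon\bar C$, $XS=\mu I_n$, $X,S\succeq0$. $X^\mu(\epsilon)$ and $S^\mu(\epsilon)$ have a common orthonormal eigenvector basis; its columns are arranged as $Q^\mu_\epsilon=(Q^\mu_{\mathcal B(\epsilon)},Q^\mu_{\mathcal T(\epsilon)},Q^\mu_{\mathcal N(\epsilon)})$, where $Q^\mu_{\mathcal B(\epsilon)}$ consists of eigenvectors for the $n_{\mathcal B}$ largest eigenvalues of $X^\mu(\epsilon)$, $Q^\mu_{\mathcal N(\epsilon)}$ of eigenvectors for the $n_{\mathcal N}$ largest eigenvalues of $S^\mu(\epsilon)$ (equivalently the $n_{\mathcal N}$ smallest of $X^\mu(\epsilon)$), and $Q^\mu_{\mathcal T(\epsilon)}$ of the remaining ones. At $\epsilon=0$ these are $Q^\mu_{\mathcal B},Q^\mu_{\mathcal T},Q^\mu_{\mathcal N}$. Quantities $\delta^\mu,\theta^\mu$: the symmetric Kronecker product is defined by $(K_1\otimes_sK_2)\operatorname{svec}(H)=\frac12\operatorname{svec}(K_2HK_1^T+K_1HK_2^T)$ for symmetric $H$, $$J(X,y,S)=\begin{pmatrix}\mathcal A&0&0\\0&\mathcal A^T&I_{n(n+1)/2}\\S\otimes_sI_n&0&X\otimes_sI_n\end{pmatrix}$$ (nonsingular at $(X^\mu,y^\mu,S^\mu)$), $\theta^\mu=\|J^{-1}(X^\mu,y^\mu,S^\mu)\|_2$, and $\delta^\mu=\min\{\lambda_{[n_{\mathcal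 B}+n_{\mathcal T}]}(X^\mu),\lambda_{[n_{\mathcal N}]}(S^\mu)\}$. Threshold $\tilde\mu$ (at $\epsilon=0$): let $Q_{\mathcal B},Q_{\mathcal N}$ have columns forming orthonormal bases of $\mathcal B,\mathcal N$. Put $\sigma_{\mathcal B}=\max_{X\in\mathcal P^*}\lambda_{\min}(Q_{\mathcal B}^TXQ_{\mathcal B})$ ($=\infty$ if $\mathcal B=\{0\}$), $\sigma_{\mathcal N}=\max_{(y,S)\in\mathcal D^*}\lambda_{\min}(Q_{\mathcal N}^TSQ_{\mathcal N})$ ($=\infty$ if $\mathcal N=\{0\}$), $\sigma=\min\{\sigma_{\mathcal B},\sigma_{\mathcal N}\}$. Fix an optimal solution $(\check X,\check y,\check S)$, and let $\bar{\mathcal L}_{\mathcal P}=\{x\in\operatorname{svec}(\check X)+\operatorname{Null}(\mathcal A):\operatorname{svec}(\check S)^Tx=0\}$, $\bar{\mathcal L}_{\mathcal D}=\{s\in\operatorname{svec}(\check S)+\mathcal R(\mathcal A^T):\operatorname{svec}(\check X)^Ts=0\}$. Let $\theta_1,\theta_2>0$ be fixed constants, independent of $\mu$, such that the Euclidean distances of $\operatorname{svec}(X^\mu)$ from $\bar{\mathcal L}_{\mathcal P}$ and of $\operatorname{svec}(S^\mu)$ from $\bar{\mathcal L}_{\mathcal D}$ are at most $\theta_1n\mu$ and $\theta_2n\mu$, respectively; put $\hat\mu=\frac1n\min\{\theta_1^{-1},\theta_2^{-1}\}$. Let $c>0$ and $\gamma\ge2^{1-n}$ be fixed constants, independent of $\mu$,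 such that for all $0<\mu\le\hat\mu$ the Frobenius distances of $X^\mu$ from $\operatorname{svec}^{-1}(\bar{\mathcal L}_{\mathcal P})\cap\mathbb S^n_+$ and of $S^\mu$ from $\operatorname{svec}^{-1}(\bar{\mathcal L}_{\mathcal D})\cap\mathbb S^n_+$ are at most $c(n\mu)^\gamma$ (such constants exist). Then $$\tilde\mu=\min\Big\{\frac1n\Big(\frac{\sigma}{cn^{3/2}}\Big)^{1/\gamma},\ \frac{\sigma^2}{n^2},\ \hat\mu\Big\}.$$ $\tilde\mu(\epsilon)$ is the analogous quantity for the problem pair $(\mathrm P_\epsilon),(\mathrm D_\epsilon)$. *)

(* Defs.v *)
From HB Require Import structures.
From mathcomp Require Import all_boot all_order all_algebra.
From mathcomp Require Import all_classical all_reals all_analysis.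

Set Implicit Arguments.
Unset Strict Implicit.
Unset Printing Implicit Defensive.

Import Order.TTheory GRing.Theory Num.Theory.
Import numFieldNormedType.Exports.

Local Open Scope classical_set_scope.
Local Open Scope ring_scope.

Section LinearAlgebra.
Context {R : realType}.

Definition inner n (C X : 'M[R]_n) : R := \tr (C *m X).

(* Frobenius norm; on column vectors this is the Euclidean norm. *)
Definition fnorm p q (M : 'M[R]_(p, q)) : R :=
  Num.sqrt (\sum_i \sum_j M i j ^+ 2).

Definition opnorm p q (M : 'M[R]_(p, q)) : R :=
  sup [set fnorm (M *m x) | x in [set x : 'cV[R]_q | fnorm x <= 1]].

Definition dist_set p q (x : 'M[R]_(p, q)) (K : set 'M[R]_(p, q)) : R :=
  inf [set fnorm (x - z) | z in K].

Definition psd n : set 'M[R]_n :=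
  [set X | X^T = X /\ forall v : 'cV[R]_n, 0 <= (v^T *m X *m v) 0 0].

Definition posdef n : set 'M[R]_n :=
  [set X | X^T = X /\ forall v : 'cV[R]_n, v != 0 -> 0 < (v^T *m X *m v) 0 0].

(* The eigenvalues with multiplicity, in nonincreasing order. They are all
   real when X is symmetric, which is the only case in which this is used. *)
Definition eigvals n (X : 'M[R]_n) : seq R :=
  xget [::] [set s | sorted >=%R s /\
                     char_poly X = \prod_(z <- s) ('X - z%:P)].

(* The i-th largest eigenvalue, with i counted from 1. *)
Definition lam n (i : nat) (X : 'M[R]_n) : R := (eigvals X)`_i.-1.

Definition lam_min k (M : 'M[R]_k) : R := lam k M.

(* A linear subspace of R^n is represented, as in mxalgebra, by the canonical
   n x n matrix whose row space it is, so that equality of subspaces is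
   Leibniz equality and dimension is \rank. The column space of Q is thus the
   row space of Q^T. *)
Definition colsp n k (Q : 'M[R]_(n, k)) : 'M[R]_n := <<Q^T>>%MS.

Definition orthc n (U : 'M[R]_n) : 'M[R]_n := <<kermx U^T>>%MS.

Definition orthproj n (U : 'M[R]_n) : 'M[R]_n := proj_mx U (orthc U).

Definition sdist n (U V : 'M[R]_n) : R := opnorm (orthproj U - orthproj V).

(* svec is indexed by the positions of the upper triangle, enumerated row by
   row; there are n(n+1)/2 of them (lemma card_upidx). *)
Definition upidx n : {set 'I_n * 'I_n} :=
  [set p : 'I_n * 'I_n | (p.1 <= p.2)%N]%SET.

Definition svec n (X : 'M[R]_n) : 'cV[R]_#|upidx n| :=
  \col_k let p := enum_val k in
         if p.1 == p.2 then X p.1 p.2 else Num.sqrt 2 * X p.1 p.2.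

(* The symmetric matrix whose svec is the k-th unit vector. *)
Definition sbasis n (k : 'I_#|upidx n|) : 'M[R]_n :=
  let p := enum_val k in
  if p.1 == p.2 then delta_mx p.1 p.2
  else (Num.sqrt 2)^-1 *: (delta_mx p.1 p.2 + delta_mx p.2 p.1).

(* The matrix characterised by lemma skronE. *)
Definition skron n (K1 K2 : 'M[R]_n) : 'M[R]_#|upidx n| :=
  \matrix_(i, j) (2^-1 *: svec (K2 *m sbasis j *m K1^T +
                                K1 *m sbasis j *m K2^T)) i 0.

Section RelativeInterior.
Context {V : normedModType R}.

Definition aff_hull (K : set V) : set V :=
  [set x | exists k (a : 'I_k -> R) (v : 'I_k -> V),
    [/\ \sum_i a i = 1, forall i, K (v i) & x = \sum_i a i *: v i]].

Definition ri (K : set V) : set V :=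
  [set x | K x /\ \forall z \near x, aff_hull K z -> K z].

End RelativeInterior.
End LinearAlgebra.

Lemma card_upidx n : #|upidx n| = (n * n.+1)./2.
Proof.
have -> : #|upidx n| = (\sum_(i < n) i.+1)%N.
  rewrite -sum1_card (eq_bigl (fun p : 'I_n * 'I_n => true && (p.1 <= p.2)%N));
    last by move=> p; rewrite inE.
  rewrite -(pair_big_dep xpredT (fun i j : 'I_n => (i <= j)%N) (fun _ _ => 1%N)).
  rewrite (exchange_big_dep xpredT) //=; apply: eq_bigr => j _.
  by rewrite -(big_ord_widen_cond n xpredT (fun=> 1%N) (ltn_ord j)) /=
             sum_nat_const card_ord muln1.
elim: n => [|n IH]; first by rewrite big_ord0.
rewrite big_ord_recr IH.
have -> : (n.+1 * n.+1.+1 = n * n.+1 + n.+1.*2)%N.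
  by rewrite -muln2 (mulnC n) -mulnDr addn2.
by rewrite halfD odd_double andbF add0n doubleK.
Qed.

Lemma svec_sbasis (R : realType) n (H : 'M[R]_n) : H^T = H ->
  H = \sum_k svec H k 0 *: sbasis k.
Proof.
move=> symH; apply/matrixP => i j; rewrite summxE.
have s2 : Num.sqrt 2 != 0 :> R by rewrite gt_eqF // sqrtr_gt0.
pose F (p : 'I_n * 'I_n) : R :=
  if p.1 == p.2 then ((i == p.1) && (j == p.2))%:R * H i j
  else ((i == p.1) && (j == p.2) || (i == p.2) && (j == p.1))%:R * H i j.
have FE k : (svec H k 0 *: sbasis k) i j = F (enum_val k).
  rewrite /svec /sbasis /F !mxE /=; case: (enum_val k) => a b /=.
  case: eqVneq => [->|ab]; rewrite !mxE.
    by case: eqVneq => [->|_]; case: eqVneq => [->|_] /=;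
       rewrite ?mulr1 ?mul1r ?mulr0 ?mul0r.
  rewrite mulrACA mulfV // mul1r mulrC.
  case: (boolP ((i == a) && (j == b))) => [/andP[/eqP-> /eqP->]|_].
    by rewrite (negPf ab) addr0.
  rewrite add0r /=; case: (boolP ((i == b) && (j == a))); last by rewrite !mul0r.
  by case/andP => /eqP-> /eqP->; rewrite -[in RHS]symH mxE.
rewrite (eq_bigr _ (fun k _ => FE k)) -(big_enum_val F).
pose q := if (i <= j)%N then (i, j) else (j, i).
have qin : q \in upidx n.
  by rewrite inE /q; case: (leqP i j) => [|/ltnW].
rewrite (bigD1 q) //= big1 ?addr0.
  rewrite /F /q; case: (leqP i j) => [_|lt] /=; rewrite !eqxx /= ?mul1r ?orbT ?mul1r.
    by case: ifP.
  have -> : (j == i) = false by apply/negP => /eqP e; rewrite e ltnn in lt.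
  by [].
move=> [a b]; rewrite inE /= => /andP[ab nq]; rewrite /F /=.
have nab : ((i == a) && (j == b)) = false.
  apply/negP => /andP[/eqP ia /eqP jb]; move: nq ab.
  by rewrite /q ia jb => + ab; rewrite ab eqxx.
have nba : a != b -> ((i == b) && (j == a)) = false.
  move=> anb; apply/negP => /andP[/eqP ib /eqP ja]; move: nq.
  have -> : q = (a, b).
    rewrite /q ib ja; case: leqP => // ba.
    by case/eqP: anb; apply/val_inj/anti_leq; rewrite ab ba.
  by rewrite eqxx.
case: eqVneq => [_|anb]; first by rewrite nab mul0r.
by rewrite nab (nba anb) mul0r.
Qed.

Lemma skronE (R : realType) n (K1 K2 H : 'M[R]_n) : H^T = H ->
  skron K1 K2 *m svec H =
  2^-1 *: svec (K2 *m H *m K1^T + K1 *m H *m K2^T).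
Proof.
move=> symH; apply/colP => i.
have svecE (M : 'M[R]_n) : svec M i 0 =
    (if (enum_val i).1 == (enum_val i).2 then 1 else Num.sqrt 2) *
    M (enum_val i).1 (enum_val i).2.
  by rewrite mxE /=; case: ifP; rewrite ?mul1r.
set w := (if _ then _ else _) in svecE.
rewrite mxE [RHS]mxE svecE [in RHS](svec_sbasis symH).
rewrite !mulmx_sumr !mulmx_suml -big_split /= summxE !mulr_sumr.
apply: eq_bigr => k _; rewrite mxE mxE svecE -!scalemxAr -!scalemxAl -scalerDr.
by rewrite [in RHS]mxE [LHS]mulrC mulrCA; congr (_ * _); rewrite mulrCA.
Qed.

(* The data of the parametric pair (P_eps), (D_eps). *)
Record psdo (R : realType) (n m : nat) := Psdo {
  objC : 'M[R]_n;
  dirC : 'M[R]_n;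
  conA : 'I_m -> 'M[R]_n;
  rhs : 'cV[R]_m;
  objC_sym : objC^T = objC;
  dirC_sym : dirC^T = dirC;
  conA_sym : forall i, (conA i)^T = conA i }.

Section Parametric.
Context {R : realType} {n m : nat}.
Variable P : psdo R n m.

Definition cost (e : R) : 'M[R]_n := objC P + e *: dirC P.

(* The primal feasible set does not depend on the parameter. *)
Definition pfeas : set 'M[R]_n :=
  [set X | psd X /\ forall i, inner (conA P i) X = rhs P i 0].

Definition dfeas (e : R) : set ('cV[R]_m * 'M[R]_n) :=
  [set w : 'cV[R]_m * 'M[R]_n |
    (\sum_i w.1 i 0 *: conA P i) + w.2 = cost e /\ psd w.2].

Definition dobj (y : 'cV[R]_m) : R := ((rhs P)^T *m y) 0 0.

Definition optval (e : R) : \bar R :=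
  ereal_inf [set (inner (cost e) X)%:E | X in pfeas].

Definition dom_eps : set R := [set e | (-oo < optval e)%E].

Definition popt (e : R) : set 'M[R]_n :=
  [set X | pfeas X /\
           forall Z, pfeas Z -> inner (cost e) X <= inner (cost e) Z].

Definition dopt (e : R) : set ('cV[R]_m * 'M[R]_n) :=
  [set w | dfeas e w /\ forall w', dfeas e w' -> dobj w'.1 <= dobj w.1].

Definition lin_indep : Prop := free [seq conA P i | i : 'I_m].

Definition interior_point : Prop :=
  exists X y S, [/\ pfeas X, dfeas 0 (y, S), posdef X & posdef S].

Definition max_compl (e : R) : set ('M[R]_n * ('cV[R]_m * 'M[R]_n)) :=
  [set w | ri (popt e) w.1 /\ ri (dopt e) w.2].

(* Some maximally complementary solution; the column spaces of its X and S
   parts do not depend on which one is chosen. *)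
Definition mc_sol (e : R) : 'M[R]_n * ('cV[R]_m * 'M[R]_n) :=
  xget 0 (max_compl e).

Definition spB (e : R) : 'M[R]_n := colsp (mc_sol e).1.
Definition spN (e : R) : 'M[R]_n := colsp (mc_sol e).2.2.
Definition spT (e : R) : 'M[R]_n := orthc (spB e + spN e)%MS.

Definition opt_partition (e : R) := (spB e, spT e, spN e).

Definition dimB (e : R) : nat := \rank (spB e).
Definition dimT (e : R) : nat := \rank (spT e).
Definition dimN (e : R) : nat := \rank (spN e).

Definition nonlinear_on (I : set R) : Prop :=
  [/\ open I, is_interval I, (exists a b, [/\ I a, I b & a != b]) &
      I `<=` interior dom_eps] /\
  [/\ (forall a b, I a -> I b -> dimB a = dimB b),
      (forall a b, I a -> I b -> dimN a = dimN b) &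
      ~ (forall a b, I a -> I b -> opt_partition a = opt_partition b)].

(* Maximal length is maximality with respect to inclusion. *)
Definition nonlinearity_interval (I : set R) : Prop :=
  nonlinear_on I /\ forall J, nonlinear_on J -> I `<=` J -> J = I.

Definition central (e mu : R) (X : 'M[R]_n) (y : 'cV[R]_m) (S : 'M[R]_n)
  : Prop :=
  [/\ forall i, inner (conA P i) X = rhs P i 0,
      (\sum_i y i 0 *: conA P i) + S = cost e,
      X *m S = mu%:M, psd X & psd S].

Definition calA : 'M[R]_(m, #|upidx n|) := \matrix_(i, k) svec (conA P i) k 0.

(* The cast only identifies the index set of the column blocks, of sizes
   N, m, N, with that of the row blocks, of sizes m, N, N, to make the matrix
   square; it does not permute anything. *)
Definition jac (X S : 'M[R]_n) : 'M[R]_(m + (#|upidx n| + #|upidx n|)) :=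
  castmx (erefl, addnCA #|upidx n| m #|upidx n|)
    (col_mx (row_mx calA (row_mx 0 0))
    (col_mx (row_mx 0 (row_mx calA^T 1%:M))
            (row_mx (skron S 1%:M) (row_mx 0 (skron X 1%:M))))).

Definition theta (X S : 'M[R]_n) : R := opnorm (invmx (jac X S)).

Definition delta (X S : 'M[R]_n) : R :=
  Num.min (lam (dimB 0 + dimT 0) X) (lam (dimN 0) S).

(* LP and LD are the affine spaces \bar{L}_P and \bar{L}_D attached to an optimal
   solution (X, y, S). *)
Definition LP (X S : 'M[R]_n) : set 'cV[R]_#|upidx n| :=
  [set x | calA *m (x - svec X) = 0 /\ (svec S)^T *m x = 0].

Definition LD (X S : 'M[R]_n) : set 'cV[R]_#|upidx n| :=
  [set s | (exists z, s = svec S + calA^T *m z) /\ (svec X)^T *m s = 0].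

Definition LP_psd (X S : 'M[R]_n) : set 'M[R]_n :=
  [set Z | psd Z /\ LP X S (svec Z)].

Definition LD_psd (X S : 'M[R]_n) : set 'M[R]_n :=
  [set Z | psd Z /\ LD X S (svec Z)].

(* An admissible choice, at the parameter value e, of everything that the
   threshold on mu depends on. *)
Record threshold (e : R) := Threshold {
  thX : 'M[R]_n;
  thy : 'cV[R]_m;
  thS : 'M[R]_n;
  th_popt : popt e thX;
  th_dopt : dopt e (thy, thS);
  thQB : 'M[R]_(n, dimB e);
  thQN : 'M[R]_(n, dimN e);
  thQB_orth : thQB^T *m thQB = 1%:M;
  thQN_orth : thQN^T *m thQN = 1%:M;
  thQB_span : colsp thQB = spB e;
  thQN_span : colsp thQN = spN e;
  th1 : R;
  th2 : R;
  thc : R;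
  thgamma : R;
  th1_gt0 : 0 < th1;
  th2_gt0 : 0 < th2;
  thc_gt0 : 0 < thc;
  thgamma_ge : 2 `^ (1 - n%:R) <= thgamma;
  th_distP : forall mu X y S, 0 < mu -> central e mu X y S ->
    dist_set (svec X) (LP thX thS) <= th1 * n%:R * mu;
  th_distD : forall mu X y S, 0 < mu -> central e mu X y S ->
    dist_set (svec S) (LD thX thS) <= th2 * n%:R * mu;
  th_hat : R := n%:R^-1 * Num.min th1^-1 th2^-1;
  th_distPpsd : forall mu X y S, 0 < mu <= th_hat -> central e mu X y S ->
    dist_set X (LP_psd thX thS) <= thc * (n%:R * mu) `^ thgamma;
  th_distDpsd : forall mu X y S, 0 < mu <= th_hat -> central e mu X y S ->
    dist_set S (LD_psd thX thS) <= thc * (n%:R * mu) `^ thgamma }.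

Section Threshold.
Context {e : R}.
Variable t : threshold e.

(* The maxima defining sigma_B and sigma_N are attained when the optimal sets
   are compact. *)
Definition sigmaB : \bar R :=
  if dimB e == 0%N then +oo%E
  else ereal_sup [set (lam_min ((thQB t)^T *m X *m thQB t))%:E
                 | X in popt e].

Definition sigmaN : \bar R :=
  if dimN e == 0%N then +oo%E
  else ereal_sup [set (lam_min ((thQN t)^T *m w.2 *m thQN t))%:E
                 | w in dopt e].

Definition sigma : \bar R := Order.min sigmaB sigmaN.

Definition mu_tilde : \bar R :=
  Order.min
    (n%:R^-1%:E *
     (sigma * (thc t * n%:R `^ (3 / 2))^-1%:E) `^ (thgamma t)^-1)%E
    (Order.min (sigma ^+ 2 * (n%:R ^+ 2)^-1%:E)%E (th_hat t)%:E).

End Threshold.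

(* (QB, QT, QN) is a common orthonormal eigenvector basis of X and S, where
   the eigenvalues of X on QB are its largest ones, and likewise for S on QN. *)
Definition eigen_arranged nB nT nN (X S : 'M[R]_n)
    (QB : 'M[R]_(n, nB)) (QT : 'M[R]_(n, nT)) (QN : 'M[R]_(n, nN)) : Prop :=
  let Q := row_mx QB (row_mx QT QN) in
  [/\ Q^T *m Q = 1%:M, Q *m Q^T = 1%:M &
  exists x s : 'rV[R]_(nB + (nT + nN)),
  [/\ X *m Q = Q *m diag_mx x, S *m Q = Q *m diag_mx s,
      perm_eq [seq lsubmx x 0 i | i : 'I_nB] (take nB (eigvals X)) &
      perm_eq [seq rsubmx (rsubmx s) 0 i | i : 'I_nN] (take nN (eigvals S))]].

End Parametric.

(* Main.v *)
(** The central path equations at parameter [e], written at the central solution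
    for [e = 0] with the symmetrised product [(X S + S X) / 2], read
    [J z = r - q z], where [J] is the Jacobian, [q] is quadratic with
    [|q z - q z'| <= |z - z'| |z + z'| / 2] and [|r| = |e| |dirC|].  The
    simplified Newton map [z |-> J^-1 (r - q z)] is a contraction of the ball of
    Kantorovich radius [rho = (1 - sqrt (1 - 2 |e| theta^2 |dirC|)) / theta].
    Its fixed point is followed along the segment from [0] to [e] in small
    steps: positive definiteness of the [X]-part cannot be lost, since
    [X S = mu I] gives [X >= (mu / |S|) I], which survives a step shorter than
    [mu / |S|].  So the perturbed central solution exists and lies within [rho]
    of the original one.  The hypotheses bound [5 rho] by the spectral gaps, and
    the bounds on the eigenspaces are then instances of the Davis-Kahan theorem
    in the Frobenius norm, applied in both directions. *)

Require Import Defs.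
From HB Require Import structures.
From mathcomp Require Import all_boot all_order all_algebra.
From mathcomp Require Import all_classical all_reals all_analysis.
From mathcomp Require Import ring lra.

Set Implicit Arguments.
Unset Strict Implicit.
Unset Printing Implicit Defensive.

Import Order.TTheory GRing.Theory Num.Theory.
Import numFieldNormedType.Exports.

Local Open Scope classical_set_scope.
Local Open Scope ring_scope.

(** * Frobenius inner product, Frobenius norm and operator norm *)

Section Frobenius.
Context {R : realType}.

Definition fdot p q (A B : 'M[R]_(p, q)) : R := \tr (A^T *m B).

Lemma fdotE p q (A B : 'M[R]_(p, q)) :
  fdot A B = \sum_i \sum_j A i j * B i j.
Proof.
rewrite /fdot /mxtrace exchange_big; apply: eq_bigr => j _.
by rewrite mxE; apply: eq_bigr => i _; rewrite mxE.
Qed.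

Lemma fdotC p q (A B : 'M[R]_(p, q)) : fdot A B = fdot B A.
Proof. by rewrite /fdot -mxtrace_tr trmx_mul trmxK. Qed.

Lemma fdotDr p q (A B C : 'M[R]_(p, q)) : fdot A (B + C) = fdot A B + fdot A C.
Proof. by rewrite /fdot mulmxDr mxtraceD. Qed.

Lemma fdotDl p q (A B C : 'M[R]_(p, q)) : fdot (A + B) C = fdot A C + fdot B C.
Proof. by rewrite fdotC fdotDr !(fdotC C). Qed.

Lemma fdotZr p q a (A B : 'M[R]_(p, q)) : fdot A (a *: B) = a * fdot A B.
Proof. by rewrite /fdot -scalemxAr mxtraceZ. Qed.

Lemma fdotZl p q a (A B : 'M[R]_(p, q)) : fdot (a *: A) B = a * fdot A B.
Proof. by rewrite fdotC fdotZr fdotC. Qed.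

Lemma fdot_ge0 p q (A : 'M[R]_(p, q)) : 0 <= fdot A A.
Proof.
by rewrite fdotE; apply: sumr_ge0 => i _; apply: sumr_ge0 => j _;
   rewrite -expr2 sqr_ge0.
Qed.

Lemma fnormE p q (A : 'M[R]_(p, q)) : fnorm A = Num.sqrt (fdot A A).
Proof. by rewrite fdotE. Qed.

Lemma fnorm_ge0 p q (A : 'M[R]_(p, q)) : 0 <= fnorm A.
Proof. exact: sqrtr_ge0. Qed.

Lemma sqr_fnorm p q (A : 'M[R]_(p, q)) : fnorm A ^+ 2 = fdot A A.
Proof. by rewrite fnormE sqr_sqrtr // fdot_ge0. Qed.

Lemma le_fnorm_sqr p q p' q' (A : 'M[R]_(p, q)) (B : 'M[R]_(p', q')) :
  fdot A A <= fdot B B -> fnorm A <= fnorm B.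
Proof. by move=> h; rewrite !fnormE ler_wsqrtr. Qed.

Lemma fdot_eq0 p q (A : 'M[R]_(p, q)) : fdot A A = 0 -> A = 0.
Proof.
rewrite fdotE => h; apply/matrixP => i j; rewrite mxE.
have h1 : \sum_k A i k * A i k = 0.
  apply/eqP; move: h => /eqP; rewrite psumr_eq0.
    by move=> /allP /(_ i); rewrite mem_index_enum => /(_ isT).
  by move=> k _; apply: sumr_ge0 => l _; rewrite -expr2 sqr_ge0.
move: h1 => /eqP; rewrite psumr_eq0; last first.
  by move=> l _; rewrite -expr2 sqr_ge0.
move=> /allP /(_ j); rewrite mem_index_enum => /(_ isT) /=.
by rewrite mulf_eq0 orbb => /eqP.
Qed.

Lemma fnorm_eq0 p q (A : 'M[R]_(p, q)) : fnorm A = 0 -> A = 0.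
Proof. by move=> h; apply: fdot_eq0; rewrite -sqr_fnorm h expr0n. Qed.

Lemma fnorm0 p q : fnorm (0 : 'M[R]_(p, q)) = 0.
Proof. by rewrite fnormE /fdot mulmx0 mxtrace0 sqrtr0. Qed.

(** Cauchy-Schwarz: the square of [|B| A - |A| B] is [2 |A| |B| (|A| |B| - <A, B>)]. Zero norms are
    split off because [|A| |B|] gets cancelled. *)
Lemma fdot_le p q (A B : 'M[R]_(p, q)) : fdot A B <= fnorm A * fnorm B.
Proof.
have [a0|a0] := eqVneq (fnorm A) 0.
  by rewrite a0 mul0r (fnorm_eq0 a0) /fdot trmx0 mul0mx mxtrace0.
have [b0|b0] := eqVneq (fnorm B) 0.
  by rewrite b0 mulr0 (fnorm_eq0 b0) /fdot mulmx0 mxtrace0.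
have ab : 0 < fnorm A * fnorm B by rewrite mulr_gt0 // lt0r ?a0 ?b0 fnorm_ge0.
have := fdot_ge0 (fnorm B *: A + (- fnorm A) *: B).
rewrite !fdotDl !fdotDr !fdotZl !fdotZr (fdotC B A) -!sqr_fnorm => h.
rewrite -(ler_pM2l ab) -subr_ge0; lra.
Qed.

Lemma fnormD p q (A B : 'M[R]_(p, q)) : fnorm (A + B) <= fnorm A + fnorm B.
Proof.
rewrite -(@ler_pXn2r _ 2) ?nnegrE ?addr_ge0 ?fnorm_ge0 //.
rewrite sqr_fnorm !fdotDl !fdotDr (fdotC B A) sqrrD !sqr_fnorm.
have := fdot_le A B; lra.
Qed.

Lemma fnormZ p q a (A : 'M[R]_(p, q)) : fnorm (a *: A) = `|a| * fnorm A.
Proof.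
by rewrite !fnormE fdotZl fdotZr mulrA -expr2 sqrtrM ?sqr_ge0 // sqrtr_sqr.
Qed.

Lemma fnormN p q (A : 'M[R]_(p, q)) : fnorm (- A) = fnorm A.
Proof. by rewrite -scaleN1r fnormZ normrN1 mul1r. Qed.

Lemma fnormB p q (A B : 'M[R]_(p, q)) : fnorm (A - B) <= fnorm A + fnorm B.
Proof. by rewrite -(fnormN B) fnormD. Qed.

Lemma fnorm_distC p q (A B : 'M[R]_(p, q)) : fnorm (A - B) = fnorm (B - A).
Proof. by rewrite -fnormN opprB. Qed.

Lemma fnorm_tr p q (A : 'M[R]_(p, q)) : fnorm A^T = fnorm A.
Proof. by rewrite !fnormE /fdot trmxK mxtrace_mulC. Qed.

Lemma fdot_sqr_le p q (A B : 'M[R]_(p, q)) :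
  fdot A B ^+ 2 <= fdot A A * fdot B B.
Proof.
rewrite -!sqr_fnorm -exprMn -(real_normK (num_real _)) ler_pXn2r ?nnegrE
  ?mulr_ge0 ?fnorm_ge0 //.
rewrite ler_norml fdot_le andbT.
by have := fdot_le (- A) B; rewrite fnormN -scaleN1r fdotZl; lra.
Qed.

(** Each entry of the product is the inner product of a row of [A] and a column of [B];
    Cauchy-Schwarz is applied entrywise and summed. *)
Lemma fnormM p q r (A : 'M[R]_(p, q)) (B : 'M[R]_(q, r)) :
  fnorm (A *m B) <= fnorm A * fnorm B.
Proof.
rewrite -(@ler_pXn2r _ 2) ?nnegrE ?mulr_ge0 ?fnorm_ge0 //.
rewrite exprMn !sqr_fnorm fdotE.
have entry i j : (A *m B) i j = fdot (row i A)^T (col j B).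
  by rewrite fdotE mxE; apply: eq_bigr => k _; rewrite big_ord1 !mxE.
have hA : fdot A A = \sum_i fdot (row i A)^T (row i A)^T.
  rewrite fdotE; apply: eq_bigr => i _; rewrite fdotE.
  by apply: eq_bigr => k _; rewrite big_ord1 !mxE.
have hB : fdot B B = \sum_j fdot (col j B) (col j B).
  rewrite fdotE exchange_big; apply: eq_bigr => i _; rewrite fdotE.
  by apply: eq_bigr => k _; rewrite big_ord1 !mxE.
rewrite hA hB mulr_suml; apply: ler_sum => i _; rewrite mulr_sumr.
by apply: ler_sum => j _; rewrite entry -expr2 fdot_sqr_le.
Qed.

Lemma sqr_fnorm_col_mx p1 p2 q (A : 'M[R]_(p1, q)) (B : 'M[R]_(p2, q)) :
  fnorm (col_mx A B) ^+ 2 = fnorm A ^+ 2 + fnorm B ^+ 2.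
Proof.
by rewrite !sqr_fnorm /fdot tr_col_mx mul_row_col mxtraceD.
Qed.

Lemma fnorm_cast p q p' q' (e : (p = p') * (q = q')) (A : 'M[R]_(p, q)) :
  fnorm (castmx e A) = fnorm A.
Proof. by case: e => e1 e2; case: _ / e1; case: _ / e2; rewrite castmx_id. Qed.

Lemma quad_fdot n (M : 'M[R]_n) (v : 'cV[R]_n) :
  (v^T *m M *m v) 0 0 = fdot v (M *m v).
Proof. by rewrite /fdot /mxtrace big_ord1 mulmxA. Qed.

Lemma quad_le n (M : 'M[R]_n) (v : 'cV[R]_n) :
  fdot v (M *m v) <= fnorm M * fdot v v.
Proof.
apply: (le_trans (fdot_le _ _)).
rewrite -sqr_fnorm expr2 mulrCA ler_wpM2l ?fnorm_ge0 //.
exact: fnormM.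
Qed.

Lemma quad_ge n (M : 'M[R]_n) (v : 'cV[R]_n) :
  - (fnorm M * fdot v v) <= fdot v (M *m v).
Proof.
have := quad_le (- M) v.
by rewrite fnormN mulNmx -scaleN1r fdotZr; lra.
Qed.

Lemma fdot_mulmx p q r (A : 'M[R]_(p, q)) (B : 'M[R]_(q, r)) (C : 'M[R]_(p, r)) :
  fdot (A *m B) C = fdot B (A^T *m C).
Proof. by rewrite /fdot trmx_mul mulmxA. Qed.

Lemma fnorm_orth n k q (Q : 'M[R]_(n, k)) (W : 'M[R]_(k, q)) :
  Q^T *m Q = 1%:M -> fnorm (Q *m W) = fnorm W.
Proof. by move=> h; rewrite !fnormE fdot_mulmx mulmxA h mul1mx. Qed.

Lemma opnorm_has_sup p q (M : 'M[R]_(p, q)) :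
  has_sup [set fnorm (M *m x) | x in [set x : 'cV[R]_q | fnorm x <= 1]].
Proof.
split; first by exists (fnorm (M *m (0 : 'cV_q))), 0; rewrite /= ?fnorm0.
exists (fnorm M) => _ [z /= hz <-]; apply: (le_trans (fnormM _ _)).
by rewrite ler_piMr ?fnorm_ge0.
Qed.

Lemma fnorm_mulmx_le p q (M : 'M[R]_(p, q)) (x : 'cV[R]_q) :
  fnorm (M *m x) <= opnorm M * fnorm x.
Proof.
have [x0|x0] := eqVneq (fnorm x) 0.
  by rewrite (fnorm_eq0 x0) mulmx0 !fnorm0 mulr0.
have xgt0 : 0 < fnorm x by rewrite lt0r x0 fnorm_ge0.
rewrite -ler_pdivrMr //; apply: sup_upper_bound; first exact: opnorm_has_sup.
have nV : `|(fnorm x)^-1| = (fnorm x)^-1 by rewrite ger0_norm ?invr_ge0 ?fnorm_ge0.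
exists ((fnorm x)^-1 *: x); first by rewrite /= fnormZ nV mulVf.
by rewrite -scalemxAr fnormZ nV mulrC.
Qed.

Lemma opnorm_ge0 p q (M : 'M[R]_(p, q)) : 0 <= opnorm M.
Proof.
apply: sup_upper_bound; first exact: opnorm_has_sup.
by exists 0; rewrite /= ?mulmx0 ?fnorm0 // ler01.
Qed.

Lemma opnorm_le_fnorm p q (M : 'M[R]_(p, q)) : opnorm M <= fnorm M.
Proof.
apply: ge_sup; first by case: (opnorm_has_sup M).
move=> _ [z /= hz <-]; apply: (le_trans (fnormM _ _)).
by rewrite ler_piMr ?fnorm_ge0.
Qed.

End Frobenius.

(** * Ordered eigenvalues, Weyl's inequality and the Davis-Kahan theorem *)

Section Spectral.
Context {R : realType}.

(** [M] is similar to the diagonal matrix, so the characteristic polynomials agree. In the uses [p]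
    is a sum of block sizes; the two orthogonality identities force [p = n]. *)
Lemma eigvals_perm n p (M : 'M[R]_n) (Q : 'M[R]_(n, p)) (x : 'rV[R]_p) :
  Q^T *m Q = 1%:M -> Q *m Q^T = 1%:M -> M *m Q = Q *m diag_mx x ->
  perm_eq [seq x 0 i | i : 'I_p] (eigvals M) /\ sorted >=%R (eigvals M).
Proof.
move=> QtQ QQt MQ.
have e : p = n.
  apply/eqP; rewrite eqn_leq (mulmx1_min QtQ) /=.
  exact: (mulmx1_min QQt).
subst p.
have cpE : char_poly M = \prod_(z <- [seq x 0 i | i : 'I_n]) ('X - z%:P).
  rewrite big_map big_enum /=.
  have -> : \prod_i ('X - (x 0 i)%:P) = char_poly (diag_mx x).
    rewrite char_poly_trig ?diag_mx_is_trig //.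
    by apply: eq_bigr => i _; rewrite mxE eqxx.
  have h1 : map_mx polyC Q^T *m map_mx polyC Q = 1%:M.
    by rewrite -map_mxM QtQ map_mx1.
  rewrite /char_poly.
  have -> : char_poly_mx (diag_mx x) =
            map_mx polyC Q^T *m char_poly_mx M *m map_mx polyC Q.
    rewrite /char_poly_mx mulmxBr mulmxBl scalar_mxC -['X%:M *m _ *m _]mulmxA h1 mulmx1.
    congr (_ - _); rewrite -!map_mxM; congr map_mx.
    by rewrite -mulmxA MQ mulmxA QtQ mul1mx.
  rewrite !det_mulmx mulrAC -det_mulmx h1 det1 mul1r //.
(* [eigvals] is picked by [xget] with default [[::]]; the sorted diagonal shows that a list as
   specified exists. *)
have : exists s : seq R, sorted >=%R s /\
    char_poly M = \prod_(z <- s) ('X - z%:P).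
  exists (sort >=%R [seq x 0 i | i : 'I_n]); split.
    by apply: sort_sorted => a b; exact: le_total.
  by rewrite cpE; apply: perm_big; rewrite perm_sym perm_sort.
move=> /(xgetPex [::]) [srt cpE2]; split => //.
by apply: prod_XsubC_eq; rewrite -cpE cpE2.
Qed.

(** An orthonormal eigenbasis cut into two blocks. No order is imposed on the eigenvalues, so that
    the blocks can be exchanged and [M] can be negated. *)
Definition eigen_split n k l (M : 'M[R]_n) (Q1 : 'M[R]_(n, k))
    (Q2 : 'M[R]_(n, l)) (x1 : 'rV[R]_k) (x2 : 'rV[R]_l) : Prop :=
  [/\ (row_mx Q1 Q2)^T *m row_mx Q1 Q2 = 1%:M,
      row_mx Q1 Q2 *m (row_mx Q1 Q2)^T = 1%:M,
      M *m Q1 = Q1 *m diag_mx x1 & M *m Q2 = Q2 *m diag_mx x2].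

Section Split.
Variables (n k l : nat) (M : 'M[R]_n) (Q1 : 'M[R]_(n, k)) (Q2 : 'M[R]_(n, l)).
Variables (x1 : 'rV[R]_k) (x2 : 'rV[R]_l).
Hypothesis H : eigen_split M Q1 Q2 x1 x2.

Lemma split_orth :
  [/\ Q1^T *m Q1 = 1%:M, Q2^T *m Q2 = 1%:M, Q1^T *m Q2 = 0, Q2^T *m Q1 = 0
    & Q1 *m Q1^T + Q2 *m Q2^T = 1%:M].
Proof.
case: H => h1 h2 _ _.
move: h2; rewrite tr_row_mx mul_row_col => h2.
by move: h1; rewrite tr_row_mx mul_col_row (scalar_mx_block k l)
  => /eq_block_mx [-> -> -> ->].
Qed.

Lemma eigen_split_sym : eigen_split M Q2 Q1 x2 x1.
Proof.
case: (split_orth) => a b c d f; case: H => _ _ h3 h4; split=> //.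
  by rewrite tr_row_mx mul_col_row a b c d -scalar_mx_block.
by rewrite tr_row_mx mul_row_col addrC.
Qed.

Lemma eigen_splitN : eigen_split (- M) Q1 Q2 (- x1) (- x2).
Proof.
by case: H => h1 h2 h3 h4; split=> //; rewrite mulNmx (h3, h4) -mulmxN;
   congr (_ *m _); apply/matrixP => i j; rewrite !mxE mulNrn.
Qed.

(** The first block takes the leading [k] entries of the sorted list, so by cancellation the second
    block is the rest of it; the three bounds are then monotonicity of the list. *)
Lemma lam_split : perm_eq [seq x1 0 i | i : 'I_k] (take k (eigvals M)) ->
  [/\ forall i, lam k M <= x1 0 i, forall j, x2 0 j <= lam k.+1 M
    & forall i j, x2 0 j <= x1 0 i].
Proof.
move=> hp; case: H => h1 h2 h3 h4.
have hM : M *m row_mx Q1 Q2 = row_mx Q1 Q2 *m diag_mx (row_mx x1 x2).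
  by rewrite mul_mx_row h3 h4 diag_mx_row mul_row_block !mulmx0 addr0 add0r.
have [hp2 srt] := eigvals_perm h1 h2 hM.
have sz : size (take k (eigvals M)) = k.
  by rewrite -(perm_size hp) size_image card_ord.
have hp3 : perm_eq [seq x2 0 i | i : 'I_l] (drop k (eigvals M)).
  rewrite -(perm_cat2l [seq x1 0 i | i : 'I_k]).
  have e : [seq row_mx x1 x2 0 i | i : 'I_(k + l)] =
      [seq x1 0 i | i : 'I_k] ++ [seq x2 0 i | i : 'I_l].
    apply: (@eq_from_nth _ 0); first by rewrite size_cat !size_image !card_ord.
    rewrite size_image card_ord => i hi; rewrite nth_cat size_image card_ord.
    rewrite (nth_map (Ordinal hi)) ?size_enum_ord //.
    have -> : nth (Ordinal hi) (enum 'I_(k + l)) i = Ordinal hi.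
      by apply: ord_inj; rewrite nth_enum_ord.
    case: ltnP => hik.
      rewrite (nth_map (Ordinal hik)) ?size_enum_ord //.
      have -> : nth (Ordinal hik) (enum 'I_k) i = Ordinal hik.
        by apply: ord_inj; rewrite nth_enum_ord.
      rewrite -(row_mxEl x1 x2); congr (row_mx _ _ _ _); exact: val_inj.
    have hil : (i - k < l)%N by rewrite ltn_subLR.
    rewrite (nth_map (Ordinal hil)) ?size_enum_ord //.
    have -> : nth (Ordinal hil) (enum 'I_l) (i - k) = Ordinal hil.
      by apply: ord_inj; rewrite nth_enum_ord.
    rewrite -(row_mxEr x1 x2); congr (row_mx _ _ _ _).
    by apply: val_inj; rewrite /= subnKC.
  rewrite -e (perm_trans hp2) // -{1}(cat_take_drop k (eigvals M)).
  by rewrite perm_cat2r perm_sym.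
have top i : exists a, [/\ (a < k)%N, (k <= size (eigvals M))%N
    & x1 0 i = (eigvals M)`_a].
  have : x1 0 i \in take k (eigvals M).
    by rewrite -(perm_mem hp); apply: map_f; rewrite mem_enum.
  move=> /(nthP 0) [a]; rewrite sz => ha <-; exists a; split=> //.
    by rewrite -[X in (X <= _)%N]sz size_take_min geq_minr.
  by rewrite nth_take.
have bot j : exists b, [/\ (k <= b)%N, (b < size (eigvals M))%N
    & x2 0 j = (eigvals M)`_b].
  have : x2 0 j \in drop k (eigvals M).
    by rewrite -(perm_mem hp3); apply: map_f; rewrite mem_enum.
  move=> /(nthP 0) [a]; rewrite size_drop => ha <-; exists (k + a)%N.
  by rewrite nth_drop leq_addr -ltn_subRL.
have mono a b : (a <= b)%N -> (b < size (eigvals M))%N ->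
    (eigvals M)`_b <= (eigvals M)`_a.
  move=> ab hb; apply: (sorted_leq_nth (@ge_trans _ R) (@ge_refl _ R) 0 srt) => //.
  by rewrite inE (leq_ltn_trans ab hb).
split=> [i|j|i j].
(* [lam k M] is the entry of index [k - 1]; the existence of [i] gives [0 < k]. *)
- have [a [ak kM ->]] := top i; have k0 := leq_ltn_trans (leq0n a) ak.
  by apply: mono; rewrite -ltnS prednK.
- by have [b [kb bM ->]] := bot j; apply: mono => //; apply: leq_ltn_trans bM.
have [a [ak _ ->]] := top i; have [b [kb bM ->]] := bot j.
by apply: mono => //; apply: ltnW; apply: leq_trans kb.
Qed.

(** A vector orthogonal to [Q1] lies in the span of [Q2], on which [M] acts diagonally. *)
Lemma quad_split_le a (v : 'cV[R]_n) : (forall j, x2 0 j <= a) ->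
  Q1^T *m v = 0 -> fdot v (M *m v) <= a * fdot v v.
Proof.
move=> ha hv; case: (split_orth) => _ b _ _ f; case: H => _ _ _ h4.
have ve : v = Q2 *m (Q2^T *m v).
  by rewrite -[LHS]mul1mx -f mulmxDl -mulmxA hv mulmx0 add0r mulmxA.
move: (Q2^T *m v) ve => u ->.
rewrite mulmxA h4 -mulmxA fdot_mulmx mulmxA b mul1mx fdot_mulmx mulmxA b mul1mx.
rewrite !fdotE mulr_sumr; apply: ler_sum => i _; rewrite !big_ord1.
rewrite mul_diag_mx mxE mulrCA ler_wpM2r ?ha // -expr2 sqr_ge0 //.
Qed.

End Split.

(* The span of the columns of [Q1'] and of the [j]-th column of [Q2'] has
   dimension [k + 1], hence meets the orthogonal complement of [Q1]. *)
Lemma weyl_split n k l l' (M M' : 'M[R]_n) (Q1 Q1' : 'M[R]_(n, k))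
    (Q2 : 'M[R]_(n, l)) (Q2' : 'M[R]_(n, l')) x1 x2 x1' x2' a (j : 'I_l') :
  eigen_split M Q1 Q2 x1 x2 -> eigen_split M' Q1' Q2' x1' x2' ->
  (forall i, x2 0 i <= a) -> (forall i, x2' 0 j <= x1' 0 i) ->
  x2' 0 j <= a + fnorm (M' - M).
Proof.
move=> H H' ha hj.
pose B := row_mx Q1' (col j Q2').
have [u u0 hu] : exists2 u : 'cV[R]_(k + 1), u != 0 & Q1^T *m (B *m u) = 0.
  pose K := kermx (Q1^T *m B)^T.
  have K0 : K != 0.
    rewrite -mxrank_eq0 mxrank_ker subn_eq0 -ltnNge.
    by apply: (leq_ltn_trans (rank_leq_col _)); rewrite addn1.
  have [i hi] : exists i, row i K != 0.
    apply/existsP; apply: contraR K0; rewrite negb_exists => /forallP h.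
    by apply/eqP/row_matrixP => i; rewrite row0; apply/eqP; move: (h i); rewrite negbK.
  exists (row i K)^T; first by rewrite -(inj_eq trmx_inj) trmxK trmx0.
  apply: trmx_inj; rewrite mulmxA trmx_mul trmxK trmx0 -row_mul mulmx_ker.
  by rewrite row0.
set v := B *m u in hu.
have := quad_split_le H ha hu.
case: (split_orth H') => o1 o2 o3 o4 _; case: H' => _ _ e1 e2.
have BB : B^T *m B = 1%:M.
  rewrite /B tr_row_mx mul_col_row o1.
  rewrite -[X in block_mx _ X]/(Q1'^T *m col j Q2') colE mulmxA o3 mul0mx.
  rewrite trmx_mul -!mulmxA o4 mulmx0 (mulmxA Q2'^T) o2 mul1mx.
  rewrite trmx_delta mul_delta_mx (scalar_mx_block k 1); congr block_mx.
  by apply/matrixP => a1 b1; rewrite !ord1 !mxE.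
have M'B : M' *m B = B *m diag_mx (row_mx x1' (x2' 0 j)%:M).
  rewrite mul_mx_row e1 diag_mx_row mul_row_block !mulmx0 addr0 add0r.
  congr row_mx; rewrite colE mulmxA e2 -!mulmxA; congr (_ *m _).
  apply/matrixP => a1 b1; rewrite !ord1 mul_diag_mx !mxE big_ord1 !mxE.
  by case: eqVneq => [->|]; rewrite ?mulr1 ?mulr0 ?mul1r ?mul0r ?eqxx ?mulr1n.
have vv : fdot v v = fdot u u by rewrite /v fdot_mulmx mulmxA BB mul1mx.
have u_gt0 : 0 < fdot u u.
  by rewrite lt0r fdot_ge0 andbT; apply: contra u0 => /eqP /fdot_eq0 ->.
have low : x2' 0 j * fdot u u <= fdot v (M' *m v).
  rewrite /v mulmxA M'B -mulmxA fdot_mulmx mulmxA BB mul1mx.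
  rewrite !fdotE mulr_sumr; apply: ler_sum => i _; rewrite !big_ord1.
  rewrite mul_diag_mx [X in _ <= _ * X]mxE [leRHS]mulrCA ler_wpM2r -?expr2 ?sqr_ge0 //.
  rewrite mxE; case: splitP => i' _; first exact: hj.
  by rewrite !ord1 mxE eqxx.
(* The Rayleigh quotient of [v] is at most [a] for [M] and at least [x2' 0 j] for [M']; the two
   differ by at most the norm of [M' - M]. *)
have := quad_le (M' - M) v.
rewrite mulmxBl -[- (M *m v)]scaleN1r fdotDr fdotZr vv => q1 q2.
rewrite -(ler_pM2r u_gt0); nra.
Qed.

(** [W = Q2'^T Q1] solves a Sylvester equation with diagonal coefficients and right-hand side
    [Q2'^T (M' - M) Q1]. It multiplies each entry of [W] by a difference of eigenvalues of size at
    least [d], so the Frobenius norm bound follows entry by entry. *)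
Lemma sin_theta n k l k' l' (M M' : 'M[R]_n) (Q1 : 'M[R]_(n, k))
    (Q2 : 'M[R]_(n, l)) (Q1' : 'M[R]_(n, k')) (Q2' : 'M[R]_(n, l'))
    x1 x2 x1' x2' d :
  M'^T = M' ->
  eigen_split M Q1 Q2 x1 x2 -> eigen_split M' Q1' Q2' x1' x2' ->
  0 < d -> (forall i j, d <= `|x1 0 i - x2' 0 j|) ->
  fnorm (Q2'^T *m Q1) <= fnorm (M' - M) / d.
Proof.
move=> symM' H H' d0 hd.
have contr p q r (U : 'M[R]_(n, p)) (V : 'M[R]_(n, q)) (E : 'M[R]_(n, r)) :
    U *m U^T + V *m V^T = 1%:M -> fnorm (U^T *m E) <= fnorm E.
  move=> f; apply: le_fnorm_sqr.
  have -> : fdot E E = fdot (U^T *m E) (U^T *m E) + fdot (V^T *m E) (V^T *m E).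
    rewrite !fdot_mulmx !trmxK -fdotDr; congr fdot.
    by rewrite !mulmxA -mulmxDl f mul1mx.
  by rewrite lerDl fdot_ge0.
case: (split_orth H) => _ _ _ _ f; case: H => _ _ e1 _.
case: (split_orth H') => _ _ _ _ f'; case: H' => _ _ _ e2'.
set W := Q2'^T *m Q1.
have eW : Q2'^T *m (M' - M) *m Q1 = diag_mx x2' *m W - W *m diag_mx x1.
  rewrite mulmxBr mulmxBl; congr (_ - _).
    rewrite -[in LHS]symM' -trmx_mul e2' trmx_mul tr_diag_mx -mulmxA //.
  by rewrite -mulmxA e1 mulmxA.
have h1 : fnorm (Q2'^T *m (M' - M) *m Q1) <= fnorm (M' - M).
  apply: (@le_trans _ _ (fnorm (Q2'^T *m (M' - M)))); last first.
    by apply: (contr _ _ _ _ Q1'); rewrite addrC.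
  rewrite -fnorm_tr trmx_mul -[leRHS]fnorm_tr.
  exact: (contr _ _ _ _ Q2).
rewrite ler_pdivlMr //; apply: le_trans h1; rewrite eW.
rewrite -[d](ger0_norm (ltW d0)) mulrC -fnormZ.
apply: le_fnorm_sqr; rewrite !fdotE; apply: ler_sum => j _; apply: ler_sum => i _.
rewrite mul_diag_mx mul_mx_diag !mxE -!expr2 -(real_normK (num_real (d * _))).
rewrite -[leRHS](real_normK (num_real _)) ler_pXn2r ?nnegrE //.
rewrite (mulrC (x2' 0 j)) -mulrBr mulrC !normrM ler_wpM2l ?normr_ge0 //.
by rewrite (ger0_norm (ltW d0)) distrC.
Qed.

(** In the decomposition [1 = (1 - Q Q^T) + Q Q^T] the projection kills the first term and fixes the
    second. Since [Q Q^T] is symmetric, representing subspaces by row spaces makes no difference. *)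
Lemma orthproj_colsp n k (Q : 'M[R]_(n, k)) : Q^T *m Q = 1%:M ->
  orthproj (colsp Q) = Q *m Q^T.
Proof.
move=> QQ; rewrite /orthproj.
have [D eD] : exists D, colsp Q = D *m Q^T.
  by apply/submxP; rewrite genmxE.
have cap0 : (colsp Q :&: orthc (colsp Q) = 0)%MS.
  apply/eqP; rewrite -submx0; apply/rV_subP => v.
  rewrite sub_capmx !genmxE => /andP[/submxP[w ->]] /sub_kermxP h.
  have [E eE] : exists E, Q^T = E *m colsp Q.
    by apply/submxP; rewrite genmxE.
  have : w *m Q^T *m (colsp Q)^T *m E^T = 0 by rewrite h mul0mx.
  rewrite -mulmxA -trmx_mul -eE trmxK -mulmxA QQ mulmx1 => ->.
  by rewrite mul0mx sub0mx.
rewrite -[LHS]mul1mx -[1%:M](subrK (Q *m Q^T)) mulmxDl proj_mx_0 //.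
  by rewrite add0r proj_mx_id // /colsp genmxE submxMl.
rewrite genmxE; apply/sub_kermxP.
by rewrite eD trmx_mul trmxK mulmxA mulmxBl mul1mx -(mulmxA Q) QQ mulmx1 subrr mul0mx.
Qed.

(** By Weyl, each block of [M'] stays within [t] of the side of the gap it belongs to, so the
    eigenvalues of opposite blocks of [M] and [M'] are separated by [d = a - b - t]. The bound
    [sin_theta] then applies in both directions. *)
Lemma davis_kahan n k l (M M' : 'M[R]_n) (Q1 Q1' : 'M[R]_(n, k))
    (Q2 Q2' : 'M[R]_(n, l)) x1 x2 x1' x2' a b :
  M^T = M -> M'^T = M' ->
  eigen_split M Q1 Q2 x1 x2 -> eigen_split M' Q1' Q2' x1' x2' ->
  (forall i, a <= x1 0 i) -> (forall j, x2 0 j <= b) ->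
  (forall i j, x2' 0 j <= x1' 0 i) ->
  5 * fnorm (M' - M) <= a - b -> 0 < a - b ->
  sdist (colsp Q1) (colsp Q1') <= 4 * fnorm (M' - M) / (a - b).
Proof.
move=> sM sM' H H' ha hb ord gap gap0.
set t := fnorm (M' - M); have t0 : 0 <= t := fnorm_ge0 _.
have h2 j : x2' 0 j <= b + t by apply: (weyl_split H H').
(* The lower bound is Weyl's upper bound for [- M] and [- M'] with the blocks exchanged. *)
have h1 i : a - t <= x1' 0 i.
  have HN := eigen_splitN (eigen_split_sym H).
  have HN' := eigen_splitN (eigen_split_sym H').
  have : (- x1') 0 i <= - a + fnorm (- M' - - M).
    apply: (weyl_split HN HN') => j; first by rewrite mxE lerN2.
    by rewrite !mxE lerN2.
  by rewrite -opprD fnormN mxE -/t; lra.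
pose d := a - b - t.
have d0 : 0 < d by rewrite /d; move: gap gap0 t0; rewrite -/t; lra.
have n1 : fnorm (Q2'^T *m Q1) <= t / d.
  apply: (sin_theta sM' H H' d0) => i j.
  apply: le_trans (ler_norm _); move: (ha i) (h2 j); rewrite /d; lra.
have n2 : fnorm (Q2^T *m Q1') <= t / d.
  rewrite /t fnorm_distC; apply: (sin_theta sM H' H d0) => i j.
  apply: le_trans (ler_norm _); move: (h1 i) (hb j); rewrite /d; lra.
case: (split_orth H) => o1 o2 _ _ f; case: (split_orth H') => o1' o2' _ _ f'.
rewrite /sdist !orthproj_colsp //; apply: (le_trans (opnorm_le_fnorm _)).
(* For projections, [P - P' = P (1 - P') - (1 - P) P']; the two terms carry the two cross products
   just bounded. *)
have -> : Q1 *m Q1^T - Q1' *m Q1'^T =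
    Q1 *m (Q1^T *m Q2') *m Q2'^T - Q2 *m (Q2^T *m Q1') *m Q1'^T.
  have -> : Q1 *m (Q1^T *m Q2') *m Q2'^T = Q1 *m Q1^T *m (1%:M - Q1' *m Q1'^T).
    by rewrite -f' addrAC subrr add0r !mulmxA.
  have -> : Q2 *m (Q2^T *m Q1') *m Q1'^T = (1%:M - Q1 *m Q1^T) *m (Q1' *m Q1'^T).
    by rewrite -f addrAC subrr add0r !mulmxA.
  by rewrite mulmxBr mulmxBl mulmx1 mul1mx; apply/matrixP => i j; rewrite !mxE; ring.
have n1' : fnorm (Q1 *m (Q1^T *m Q2') *m Q2'^T) <= t / d.
  rewrite -mulmxA fnorm_orth // -fnorm_tr trmx_mul trmxK fnorm_orth //.
  by rewrite trmx_mul trmxK.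
have n2' : fnorm (Q2 *m (Q2^T *m Q1') *m Q1'^T) <= t / d.
  by rewrite -mulmxA fnorm_orth // -fnorm_tr trmx_mul trmxK fnorm_orth // fnorm_tr.
apply: (le_trans (fnormB _ _)); apply: (le_trans (lerD n1' n2')).
(* The gap condition gives [a - b <= 2 d]; two terms of size [2 t / (a - b)] make the constant 4. *)
have td : t / d <= 2 * t / (a - b).
  rewrite ler_pdivrMr // mulrAC ler_pdivlMr // (mulrC 2) -!mulrA ler_wpM2l //.
  by rewrite /d; move: gap; rewrite -/t; lra.
by move: td; rewrite -!mulrA; lra.
Qed.

End Spectral.

(** * The isometry [svec] and its inverse *)

Section Svec.
Context {R : realType} {n : nat}.
Implicit Types (H K : 'M[R]_n).

Lemma svecD H K : svec (H + K) = svec H + svec K.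
Proof. by apply/colP => k; rewrite !mxE /=; case: ifP => _; rewrite !mxE ?mulrDr. Qed.

Lemma svecZ a H : svec (a *: H) = a *: svec H.
Proof. by apply/colP => k; rewrite !mxE /=; case: ifP => _; rewrite !mxE // mulrCA. Qed.

Lemma svec0 : svec (0 : 'M[R]_n) = 0.
Proof. by rewrite -(scale0r (0 : 'M[R]_n)) svecZ scale0r. Qed.

Lemma svecN H : svec (- H) = - svec H.
Proof. by rewrite -scaleN1r svecZ scaleN1r. Qed.

Lemma svec_sum (J : finType) (F : J -> 'M[R]_n) :
  svec (\sum_i F i) = \sum_i svec (F i).
Proof. exact: (big_morph _ svecD svec0). Qed.

Definition smat (v : 'cV[R]_#|upidx n|) : 'M[R]_n := \sum_k v k 0 *: sbasis k.

Lemma smatD v w : smat (v + w) = smat v + smat w.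
Proof.
by rewrite /smat -big_split; apply: eq_bigr => k _; rewrite mxE scalerDl.
Qed.

Lemma smatN v : smat (- v) = - smat v.
Proof.
by rewrite /smat -sumrN; apply: eq_bigr => k _; rewrite mxE scaleNr.
Qed.

Lemma sym_smat v : (smat v)^T = smat v.
Proof.
rewrite /smat linear_sum; apply: eq_bigr => k _; rewrite linearZ /=.
congr (_ *: _); rewrite /sbasis; case: eqVneq => [->|_]; first exact: trmx_delta.
by rewrite linearZ /= linearD /= !trmx_delta addrC.
Qed.

Lemma smat_svec H : H^T = H -> smat (svec H) = H.
Proof. by move=> sH; rewrite /smat -svec_sbasis. Qed.

Lemma svec_smat v : svec (smat v) = v.
Proof.
have basis k : svec (sbasis k : 'M[R]_n) = delta_mx k 0.
  apply/colP => l; rewrite !mxE /= eqxx andbT.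
  have := enum_valP k; have := enum_valP l.
  have : (l == k) = (enum_val l == enum_val k) by rewrite (inj_eq enum_val_inj).
  rewrite /sbasis; case: (enum_val l) => a b; case: (enum_val k) => c d /= ->.
  rewrite !inE /= xpair_eqE => ab cd.
  case: (eqVneq a b) => [->|nab]; case: (eqVneq c d) => [->|ncd].
  - by rewrite mxE.
  - have e : (b == c) && (b == d) = false.
      by apply/negP => /andP[/eqP bc /eqP bd]; rewrite -bc -bd eqxx in ncd.
    by rewrite !mxE [(b == d) && _]andbC e addr0 mulr0.
  - rewrite mxE; have -> : (a == d) && (b == d) = false; last by rewrite mulr0.
    by apply/negP => /andP[/eqP ad /eqP bd]; rewrite ad bd eqxx in nab.
  rewrite !mxE mulrA divff ?mul1r; last by rewrite gt_eqF // sqrtr_gt0.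
  (* Both pairs lie in the upper triangle, so they can be mirror images only on the diagonal. *)
  case: (boolP ((a == d) && (b == c))) => [/andP[/eqP ad /eqP bc]|_];
    last by rewrite addr0.
  have e : a = b.
    by apply/val_inj/anti_leq; rewrite ab /= bc ad.
  by rewrite e eqxx in nab.
rewrite /smat svec_sum; apply/colP => l; rewrite summxE (bigD1 l) //=.
rewrite big1 ?addr0; first by rewrite svecZ basis !mxE !eqxx mulr1.
by move=> k kl; rewrite svecZ basis !mxE eq_sym (negPf kl) mulr0.
Qed.

Lemma svec_inj H K : H^T = H -> K^T = K -> svec H = svec K -> H = K.
Proof. by move=> sH sK e; rewrite -(smat_svec sH) e smat_svec. Qed.

(** The factor [sqrt 2] makes each entry above the diagonal count twice, once for its mirror image
    below. *)
Lemma fdot_svec H K : H^T = H -> K^T = K -> fdot (svec H) (svec K) = fdot H K.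
Proof.
move=> sH sK; rewrite !fdotE.
pose F (p : 'I_n * 'I_n) := H p.1 p.2 * K p.1 p.2.
have FC p : F (p.2, p.1) = F p.
  by rewrite /F /= -[in LHS]sH -[in LHS]sK !mxE.
have -> : \sum_i \sum_j svec H i j * svec K i j =
    \sum_(p in upidx n) (F p + (if p.1 != p.2 then F p else 0)).
  rewrite [RHS]big_enum_val; apply: eq_bigr => k _; rewrite big_ord1 !mxE /= /F.
  case: eqVneq => [->|_] /=; first by rewrite addr0.
  rewrite mulrACA -expr2 sqr_sqrtr ?ler0n //; ring.
rewrite big_split /= -big_mkcondr /= pair_big /=.
rewrite [RHS](bigID (fun p : 'I_n * 'I_n => p.1 <= p.2)%N) /=; congr (_ + _).
  by apply: eq_bigl => p; rewrite inE.
pose swp (p : 'I_n * 'I_n) := (p.2, p.1).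
have swK : involutive swp by case.
rewrite (reindex_inj (inv_inj swK)); apply: eq_big => [p|p _] /=; last exact: FC.
by rewrite inE /= -ltnNge [RHS]ltn_neqAle andbC -val_eqE.
Qed.

Lemma fnorm_svec H : H^T = H -> fnorm (svec H) = fnorm H.
Proof. by move=> sH; rewrite !fnormE fdot_svec. Qed.

End Svec.

(** * Positive definite matrices, the Lyapunov equation and central pairs *)

Section Definite.
Context {R : realType}.

(** Cholesky factorisation, by induction through the Schur complement of the top left entry. *)
Lemma posdef_ex_factor n (S : 'M[R]_n) : posdef S -> exists L : 'M[R]_n, S = L^T *m L.
Proof.
elim: n S => [|n IH]; first by move=> S _; exists 0; apply/matrixP => -[].
rewrite -[n.+1]/(1 + n)%N => S [symS posS].
pose a : 'M[R]_1 := ulsubmx S.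
pose b : 'M[R]_(n, 1) := dlsubmx S.
pose D : 'M[R]_n := drsubmx S.
have eS : S = block_mx a b^T b D.
  rewrite -[LHS]submxK; congr block_mx.
  by rewrite /b trmx_dlsub; congr ursubmx; exact: esym symS.
pose c := a 0 0.
have ea : a = c%:M by rewrite [LHS]mx11_scalar.
have symD : D^T = D by rewrite /D trmx_drsub; congr drsubmx; exact: symS.
have quad (u : 'cV[R]_1) (v : 'cV[R]_n) : col_mx u v != 0 ->
    0 < fdot u (c *: u) + fdot u (b^T *m v) + (fdot v (b *m u) + fdot v (D *m v)).
  move=> /posS; rewrite quad_fdot eS mul_block_col ea mul_scalar_mx.
  by rewrite /fdot tr_col_mx mul_row_col mxtraceD !mulmxDr !mxtraceD.
have c0 : 0 < c.
  have := quad 1%:M 0; rewrite !mulmx0 /fdot trmx0 !mul0mx !mulmx0 !mxtrace0 !addr0.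
  rewrite trmx1 mul1mx mxtraceZ mxtrace1 mulr1; apply.
  apply/eqP => /(congr1 (fun M : 'cV_(1 + n) => M (lshift n 0) 0)).
  by rewrite col_mxEu !mxE eqxx => /eqP; rewrite oner_eq0.
have [L' eL'] : exists L' : 'M[R]_n, D - c^-1 *: (b *m b^T) = L'^T *m L'.
  apply: IH; split.
    by rewrite linearB /= linearZ /= trmx_mul trmxK symD.
  move=> v v0; rewrite quad_fdot.
  (* This first component minimises the form for fixed [v], and the minimum is the form of the Schur
     complement. *)
  have := quad (- c^-1 *: (b^T *m v)) v.
  have -> : (col_mx (- c^-1 *: (b^T *m v)) v != 0).
    by apply: contra v0; rewrite col_mx_eq0 => /andP[].
  move=> /(_ isT); rewrite !fdotZl !fdotZr -scalemxAr fdotZr.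
  rewrite mulmxBl -[X in fdot v (_ + X)]scaleN1r fdotDr fdotZr -scalemxAl fdotZr.
  have -> : fdot v (b *m (b^T *m v)) = fdot (b^T *m v) (b^T *m v).
    by rewrite fdot_mulmx trmxK.
  rewrite -mulmxA; have -> : fdot v (b *m (b^T *m v)) = fdot (b^T *m v) (b^T *m v).
    by rewrite fdot_mulmx trmxK.
  have cV : c * c^-1 = 1 by rewrite divff // gt_eqF.
  set z := fdot (b^T *m v) _.
  have -> : - c^-1 * (c * (- c^-1 * z)) = c^-1 * z.
    by rewrite !mulrA mulNr (mulrC c^-1) cV; ring.
  lra.
pose s := Num.sqrt c.
have s0 : s != 0 by rewrite gt_eqF // sqrtr_gt0.
have ss : s * s = c by rewrite -expr2 sqr_sqrtr ?ltW.
exists (block_mx s%:M (s^-1 *: b^T) 0 L' : 'M[R]_(1 + n)).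
rewrite eS [in RHS]tr_block_mx mulmx_block !tr_scalar_mx trmx0 !mul0mx !mulmx0.
have -> : (s^-1 *: b^T)^T = s^-1 *: b by rewrite linearZ /= trmxK.
rewrite !addr0 -eL' ea; congr block_mx.
- by rewrite -scalar_mxM ss.
- by rewrite mul_scalar_mx scalerA divff // scale1r.
- by rewrite mul_mx_scalar scalerA divff // scale1r.
- by rewrite -scalemxAl -scalemxAr scalerA -invfM ss addrC subrK.
Qed.

Lemma mulmx_scalarC n (X S : 'M[R]_n) mu : X^T = X -> S^T = S ->
  X *m S = mu%:M -> S *m X = mu%:M.
Proof. by move=> sX sS /(congr1 trmx); rewrite trmx_mul sX sS tr_scalar_mx. Qed.

(* Evaluate the form of [X] at [v - S v / s]. *)
Lemma central_quad_ge n (X S : 'M[R]_n) (mu s : R) (v : 'cV[R]_n) :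
  psd X -> S^T = S -> X *m S = mu%:M -> 0 < mu -> 0 < s -> fnorm S <= s ->
  mu / s * fdot v v <= fdot v (X *m v).
Proof.
move=> [sX pX] sS XS mu0 s0 Ss.
have SX := mulmx_scalarC sX sS XS.
have := pX (v - s^-1 *: (S *m v)); rewrite quad_fdot.
have -> : X *m (v - s^-1 *: (S *m v)) = X *m v - (mu / s) *: v.
  by rewrite mulmxBr -scalemxAr mulmxA XS mul_scalar_mx scalerA mulrC.
rewrite -[- (mu / s *: v)]scaleNr -[- (s^-1 *: _)]scaleNr !fdotDl !fdotDr !fdotZl !fdotZr.
have -> : fdot (S *m v) (X *m v) = mu * fdot v v.
  by rewrite fdot_mulmx sS mulmxA SX mul_scalar_mx fdotZr.
rewrite [fdot (S *m v) v]fdotC => h.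
have h2 : fdot v (S *m v) <= s * fdot v v.
  by apply: (le_trans (quad_le _ _)); rewrite ler_wpM2r // fdot_ge0.
have h3 : s^-1 * (mu / s) * fdot v (S *m v) <= mu / s * fdot v v.
  have -> : mu / s * fdot v v = s^-1 * (mu / s) * (s * fdot v v).
    by rewrite [s^-1 * _]mulrC mulrA mulfVK ?gt_eqF.
  by rewrite ler_wpM2l // mulr_ge0 ?divr_ge0 ?invr_ge0 ?ltW.
move: h h3; move: (fdot v (X *m v)) (fdot v v) (fdot v (S *m v)) => p q r.
by move: s^-1 => t; lra.
Qed.

Lemma posdef_ge n (X : 'M[R]_n) k : X^T = X -> 0 < k ->
  (forall v : 'cV[R]_n, k * fdot v v <= fdot v (X *m v)) -> posdef X.
Proof.
move=> sX k0 h; split=> // v v0; rewrite quad_fdot; apply: lt_le_trans (h v).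
rewrite mulr_gt0 // lt0r fdot_ge0 andbT.
by apply: contra v0 => /eqP /fdot_eq0 ->.
Qed.

Lemma posdef_central n (X S : 'M[R]_n) mu :
  psd X -> S^T = S -> X *m S = mu%:M -> 0 < mu -> posdef X.
Proof.
move=> pX sS XS mu0; have sX := pX.1.
(* Adding 1 covers [S = 0], which occurs in dimension 0. *)
have s0 : 0 < fnorm S + 1 by rewrite ltr_wpDl ?fnorm_ge0.
apply: (@posdef_ge _ _ (mu / (fnorm S + 1))) => //; first exact: divr_gt0.
by move=> v; apply: central_quad_ge XS _ _ _; rewrite ?lerDl.
Qed.

Lemma posdef_unit n (X : 'M[R]_n) : posdef X -> X \in unitmx.
Proof.
move=> [sX pX]; rewrite -row_free_unit -kermx_eq0; apply/eqP/row_matrixP => i.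
rewrite row0; apply/eqP/negPn/negP => r0.
have : (row i (kermx X))^T != 0 by rewrite -(inj_eq trmx_inj) trmxK trmx0.
by move=> /pX; rewrite trmxK -row_mul mulmx_ker row0 mul0mx mxE ltxx.
Qed.

(** Multiplying by [K] and taking traces gives [tr (K X K) = 0], which is the sum of the values of
    the form of [X] at the columns of [K]. *)
Lemma lyapunov_inj n (X K : 'M[R]_n) : posdef X -> K^T = K ->
  K *m X + X *m K = 0 -> K = 0.
Proof.
move=> [sX pX] sK h.
have t0 : \tr (K *m X *m K) = 0.
  have : \tr ((K *m X + X *m K) *m K) = 0 by rewrite h mul0mx mxtrace0.
  rewrite mulmxDl mxtraceD [X in _ + X]mxtrace_mulC mulmxA => /eqP.
  by rewrite -mulr2n mulrn_eq0 /= => /eqP.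
have diag i : (K *m X *m K) i i = ((col i K)^T *m X *m col i K) 0 0.
  by rewrite tr_col sK !colE !mulmxA -row_mul -row_mul -colE !mxE.
have diag_ge0 i : 0 <= ((col i K)^T *m X *m col i K) 0 0.
  have [->|/pX /ltW //] := eqVneq (col i K) 0.
  by rewrite mulmx0 mxE.
apply/matrixP => i j; rewrite mxE.
have : col j K = 0.
  apply/eqP/negPn/negP => /pX; rewrite -diag.
  suff -> : (K *m X *m K) j j = 0 by rewrite ltxx.
  move: t0 => /eqP; rewrite /mxtrace psumr_eq0; last by move=> k _; rewrite diag.
  by move=> /allP /(_ j); rewrite mem_index_enum => /(_ isT) /eqP.
by move=> /colP /(_ i); rewrite !mxE.
Qed.

(** [S] and [mu X^-1] solve the same Lyapunov equation, so they coincide. Semidefiniteness of [S]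
    thus comes for free, and only [X] has to be controlled along the path. *)
Lemma central_of_sym n (X S : 'M[R]_n) mu : posdef X -> S^T = S -> 0 < mu ->
  2^-1 *: (X *m S + S *m X) = mu%:M -> X *m S = mu%:M /\ psd S.
Proof.
move=> pX sS mu0 h; have uX := posdef_unit pX; have sX := pX.1.
have sV : (invmx X)^T = invmx X by rewrite trmx_inv sX.
have eS : S = mu *: invmx X.
  apply/eqP; rewrite -subr_eq0; apply/eqP; apply: (lyapunov_inj pX).
    by rewrite linearB /= linearZ /= sS sV.
  rewrite mulmxBl mulmxBr -scalemxAl -scalemxAr mulVmx // mulmxV // scalemx1.
  have : X *m S + S *m X = 2 *: mu%:M.
    by rewrite -h scalerA mulfV ?pnatr_eq0 // scale1r.
  rewrite scaler_nat mulr2n => e.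
  by rewrite addrACA [S *m X + _]addrC e -opprD subrr.
have XS : X *m S = mu%:M by rewrite eS -scalemxAr mulmxV // scalemx1.
split=> //; split=> // v; rewrite quad_fdot.
(* This turns the form of [S] at [v] into a multiple of the form of [X] at [S v]. *)
have -> : S *m v = mu^-1 *: (S *m (X *m (S *m v))).
  rewrite (mulmxA S) (mulmx_scalarC sX sS XS) mul_scalar_mx scalerA.
  by rewrite mulVf ?gt_eqF // scale1r.
rewrite fdotZr; apply: mulr_ge0; first by rewrite invr_ge0 ltW.
have [->|/pX.2 /ltW] := eqVneq (S *m v) 0.
  by rewrite !mulmx0 /fdot mulmx0 mxtrace0.
by rewrite quad_fdot fdot_mulmx sS.
Qed.

End Definite.

(** * Fixed points of contractions and of quadratic perturbations of linear maps *)

Section FixedPoint.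
Context {R : realType}.

(** With the reverse comparison below, this carries convergence between the maximum norm and the
    Euclidean norm. *)
Lemma mx_norm_le_fnorm p q (M : 'M[R]_(p, q)) : `|M| <= fnorm M.
Proof.
rewrite [`|M|]mx_normrE; apply: bigmax_le => [|[i j] _]; first exact: fnorm_ge0.
rewrite -(@ler_pXn2r _ 2) ?nnegrE ?fnorm_ge0 // sqr_fnorm real_normK ?num_real //.
rewrite fdotE (bigD1 i) //= (bigD1 j) //= -expr2 -addrA lerDl.
by apply: addr_ge0; do ?[apply: sumr_ge0 => ? _]; rewrite -expr2 sqr_ge0.
Qed.

Lemma fnorm_le_mx_norm p q (M : 'M[R]_(p, q)) :
  fnorm M <= Num.sqrt (p * q)%:R * `|M|.
Proof.
rewrite -(@ler_pXn2r _ 2) ?nnegrE ?mulr_ge0 ?fnorm_ge0 ?sqrtr_ge0 //.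
rewrite sqr_fnorm exprMn sqr_sqrtr ?ler0n // fdotE.
have -> : (p * q)%:R * `|M| ^+ 2 = \sum_(i < p) \sum_(j < q) `|M| ^+ 2.
  by rewrite !sumr_const !card_ord -mulrnA mulr_natl mulnC.
apply: ler_sum => i _; apply: ler_sum => j _.
rewrite -expr2 -(real_normK (num_real (M i j))) ler_pXn2r ?nnegrE //.
by rewrite [`|M|]mx_normrE; exact: (le_bigmax _ (fun ij => `|M ij.1 ij.2|) (i, j)).
Qed.

(* Banach's theorem for the Euclidean norm; the norm carried by matrices in the
   library is the maximum norm, for which [G] need not be a contraction. *)
Lemma contraction_fixpoint p (G : 'cV[R]_p -> 'cV[R]_p) (rho kappa : R) :
  0 <= rho -> 0 <= kappa < 1 ->
  (forall z, fnorm z <= rho -> fnorm (G z) <= rho) ->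
  (forall z z', fnorm z <= rho -> fnorm z' <= rho ->
     fnorm (G z - G z') <= kappa * fnorm (z - z')) ->
  exists z, fnorm z <= rho /\ G z = z.
Proof.
move=> rho0 /andP[k0 k1] Gball Gcontr.
pose u k := iter k G 0.
have uball k : fnorm (u k) <= rho.
  by elim: k => [|k IH] /=; [rewrite fnorm0 | exact: Gball].
have step k : fnorm (u k.+1 - u k) <= rho * kappa ^+ k.
  elim: k => [|k IH]; first by rewrite expr0 mulr1 subr0; exact: (uball 1%N).
  rewrite exprS mulrCA; apply: le_trans (ler_wpM2l k0 IH).
  exact: (Gcontr (u k.+1) (u k)).
(* The increments are dominated by a geometric series, so the telescoping series converges
   absolutely. *)
have cu : cvgn (u : ('cV[R]_p)^nat).
  have : cvgn (series (telescope (u : ('cV[R]_p)^nat))).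
    have : cvgn [normed series (telescope (u : ('cV[R]_p)^nat))].
      apply: (@series_le_cvg _ _ (geometric rho kappa)).
      - by move=> k; exact: normr_ge0.
      - by move=> k; rewrite /= mulr_ge0 // exprn_ge0.
      - move=> k; exact: le_trans (mx_norm_le_fnorm _) (step k).
      by apply: is_cvg_geometric_series; rewrite ger0_norm.
    move=> /cauchy_cvgP/cauchy_seriesP ncvg.
    apply/cauchy_cvgP/cauchy_seriesP => e /ncvg; apply: filterS => n /=.
    rewrite ger0_norm ?sumr_ge0 //.
    by apply: le_lt_trans; exact: ler_norm_sum.
  rewrite telescopeK; under eq_fun do rewrite /= subr0.
  by [].
pose z := limn (u : ('cV[R]_p)^nat).
have close e : 0 < e -> exists N, forall k, (N <= k)%N -> fnorm (z - u k) <= e.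
  move=> e0; pose C := Num.sqrt (p * 1)%:R + 1 : R.
  have C0 : 0 < C by rewrite ltr_wpDl ?sqrtr_ge0.
  move: (cu) => /cvgrPdist_le /(_ (e / C) (divr_gt0 e0 C0)) [N _ HN].
  exists N => k Nk; apply: (le_trans (fnorm_le_mx_norm _)).
  apply: (@le_trans _ _ (C * (e / C))); last by rewrite mulrC divfK ?gt_eqF.
  by apply: ler_pM; rewrite ?sqrtr_ge0 ?normr_ge0 ?lerDl //; exact: HN.
have zball : fnorm z <= rho.
  apply/ler_addgt0Pr => e /close [N /(_ N (leqnn N)) h].
  rewrite -(subrK (u N) z) addrC; apply: (le_trans (fnormD _ _)).
  by rewrite lerD.
exists z; split=> //; apply/eqP; rewrite -subr_eq0; apply/eqP/fnorm_eq0/eqP.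
rewrite eq_le fnorm_ge0 andbT; apply/ler_addgt0Pr => e e0; rewrite add0r.
have [N HN] := close _ (divr_gt0 e0 (ltr0n _ 2)).
have -> : G z - z = (G z - G (u N)) - (z - u N.+1) by rewrite opprB addrA subrK.
apply: (le_trans (fnormB _ _)); rewrite [leRHS](splitr e).
apply: lerD; last exact: HN.
apply: (le_trans (Gcontr _ _ zball (uball N))).
apply: (@le_trans _ _ (1 * fnorm (z - u N))); last by rewrite mul1r HN.
by rewrite ler_wpM2r ?fnorm_ge0 // ltW.
Qed.

Section Quadratic.
Variables (p : nat) (K : 'M[R]_p) (th : R) (Q : 'cV[R]_p -> 'cV[R]_p).
Hypothesis th0 : 0 <= th.
Hypothesis Kth : forall v : 'cV[R]_p, fnorm (K *m v) <= th * fnorm v.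
Hypothesis Q0 : Q 0 = 0.
Hypothesis Qlip : forall z z',
  fnorm (Q z - Q z') <= 2^-1 * fnorm (z - z') * fnorm (z + z').

(** On the ball [|z + z'| <= 2 rho], so [Q] is [rho]-Lipschitz there. Allowing [r] and [r'] to
    differ serves both existence and dependence on the parameter. *)
Lemma quadratic_contr rho r r' z z' :
  fnorm z <= rho -> fnorm z' <= rho ->
  fnorm (K *m (r - Q z) - K *m (r' - Q z'))
    <= th * fnorm (r - r') + th * rho * fnorm (z - z').
Proof.
move=> hz hz'; rewrite -mulmxBr.
have -> : r - Q z - (r' - Q z') = (r - r') - (Q z - Q z').
  by apply/colP => i; rewrite !mxE; ring.
apply: (le_trans (Kth _)); rewrite -mulrA -mulrDr ler_wpM2l //.
apply: (le_trans (fnormB _ _)); rewrite lerD2l.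
apply: (le_trans (Qlip _ _)).
have := fnormD z z'; have := fnorm_ge0 (z - z'); nra.
Qed.

(** Since [|Q z| <= rho^2 / 2] on the ball, the last hypothesis makes the ball invariant. *)
Lemma quadratic_fixpoint rho r : 0 <= rho -> th * rho < 1 ->
  th * fnorm r + th / 2 * rho ^+ 2 <= rho ->
  exists z, fnorm z <= rho /\ K *m (r - Q z) = z.
Proof.
move=> rho0 lt1 hr.
apply: (@contraction_fixpoint p (fun z => K *m (r - Q z)) rho (th * rho)) => //.
- by rewrite lt1 mulr_ge0.
- move=> z hz; apply: (le_trans (Kth _)); apply: le_trans hr.
  rewrite -mulrA -mulrDr ler_wpM2l //; apply: (le_trans (fnormB _ _)).
  rewrite lerD2l; have := Qlip z 0; rewrite Q0 !subr0 addr0 => h.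
  apply: (le_trans h); have := fnorm_ge0 z; nra.
- move=> z z' hz hz'; have := quadratic_contr r r hz hz'.
  by rewrite subrr fnorm0 mulr0 add0r.
Qed.

(** Lipschitz dependence of the fixed point on [r]; it controls the step length in the
    continuation. *)
Lemma quadratic_fixpoint_dist rho r r' z z' : th * rho < 1 ->
  fnorm z <= rho -> fnorm z' <= rho ->
  K *m (r - Q z) = z -> K *m (r' - Q z') = z' ->
  fnorm (z - z') <= th * fnorm (r - r') / (1 - th * rho).
Proof.
move=> lt1 hz hz' e e'; rewrite ler_pdivlMr ?subr_gt0 //.
by have := quadratic_contr r r' hz hz'; rewrite e e'; lra.
Qed.

End Quadratic.
End FixedPoint.

(** * Closure properties of symmetric matrices *)

Section Symmetric.
Context {R : realType} {n : nat}.
Implicit Types A B : 'M[R]_n.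

Lemma trmx_symD A B : A^T = A -> B^T = B -> (A + B)^T = A + B.
Proof. by move=> sA sB; rewrite linearD /= sA sB. Qed.

Lemma trmx_symZ a A : A^T = A -> (a *: A)^T = a *: A.
Proof. by move=> sA; rewrite linearZ /= sA. Qed.

Lemma trmx_symM A B : A^T = A -> B^T = B -> (A *m B + B *m A)^T = A *m B + B *m A.
Proof. by move=> sA sB; rewrite linearD /= !trmx_mul sA sB addrC. Qed.

End Symmetric.

(** * The Jacobian and the exact expansion of the central path equations *)

Section Jacobian.
Context {R : realType} {n m : nat}.
Variable P : psdo R n m.

Local Notation N := #|upidx n|.

Lemma calA_svec (H : 'M[R]_n) : H^T = H ->
  calA P *m svec H = \col_i inner (conA P i) H.
Proof.
move=> sH; apply/colP => i; rewrite !mxE /inner.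
transitivity (fdot (svec (conA P i)) (svec H)).
  by rewrite fdotE; apply: eq_bigr => k _; rewrite big_ord1 !mxE.
by rewrite fdot_svec ?conA_sym // /fdot conA_sym.
Qed.

Lemma calA_tr (y : 'cV[R]_m) : (calA P)^T *m y = svec (\sum_i y i 0 *: conA P i).
Proof.
rewrite svec_sum; apply/colP => k; rewrite mxE summxE.
by apply: eq_bigr => i _; rewrite svecZ !mxE mulrC.
Qed.

Lemma sym_lin_comb (y : 'cV[R]_m) :
  (\sum_i y i 0 *: conA P i)^T = \sum_i y i 0 *: conA P i.
Proof.
by rewrite linear_sum; apply: eq_bigr => i _; rewrite linearZ /= conA_sym.
Qed.

Lemma lin_comb_eq0 (y : 'cV[R]_m) : lin_indep P ->
  \sum_i y i 0 *: conA P i = 0 -> y = 0.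
Proof.
move=> hfree h; apply/colP => i; rewrite mxE.
have : free (mktuple (conA P)) by exact: hfree.
move=> /freeP /(_ (fun i => y i 0)); apply; rewrite -[RHS]h.
by apply: eq_bigr => j _; rewrite (nth_map j) ?size_enum_ord // nth_ord_enum.
Qed.

(** Undoes on vectors the cast of the columns of [jac], so that a direction can be cut into its [X],
    [y] and [S] blocks. *)
Definition splitz (z : 'cV[R]_(m + (N + N))) : 'cV[R]_(N + (m + N)) :=
  castmx (esym (addnCA N m N), erefl) z.
Definition dX z : 'M[R]_n := smat (usubmx (splitz z)).
Definition dY z : 'cV[R]_m := usubmx (dsubmx (splitz z)).
Definition dS z : 'M[R]_n := smat (dsubmx (dsubmx (splitz z))).

Lemma splitzE z :
  splitz z = col_mx (svec (dX z)) (col_mx (dY z) (svec (dS z))).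
Proof. by rewrite !svec_smat !vsubmxK. Qed.

Lemma splitzD z z' : splitz (z + z') = splitz z + splitz z'.
Proof. by apply/matrixP => i j; rewrite !(castmxE, mxE). Qed.

Lemma splitzN z : splitz (- z) = - splitz z.
Proof. by apply/matrixP => i j; rewrite !(castmxE, mxE). Qed.

Lemma dXD z z' : dX (z + z') = dX z + dX z'.
Proof. by rewrite /dX splitzD linearD smatD. Qed.

Lemma dXN z : dX (- z) = - dX z.
Proof. by rewrite /dX splitzN linearN smatN. Qed.

Lemma dX0 : dX (0 : 'cV[R]_(m + (N + N))) = 0.
Proof. by rewrite -[LHS]addr0 -(subrr (dX 0)) addrA -dXD addr0 subrr. Qed.

Lemma dSD z z' : dS (z + z') = dS z + dS z'.
Proof. by rewrite /dS splitzD !linearD smatD. Qed.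

Lemma dSN z : dS (- z) = - dS z.
Proof. by rewrite /dS splitzN !linearN smatN. Qed.

Lemma sym_dX z : (dX z)^T = dX z. Proof. exact: sym_smat. Qed.
Lemma sym_dS z : (dS z)^T = dS z. Proof. exact: sym_smat. Qed.

Lemma sqr_fnorm_blocks z :
  fnorm z ^+ 2 = fnorm (dX z) ^+ 2 + (fnorm (dY z) ^+ 2 + fnorm (dS z) ^+ 2).
Proof.
rewrite -(fnorm_svec (sym_dX z)) -(fnorm_svec (sym_dS z)).
by rewrite -!sqr_fnorm_col_mx -splitzE fnorm_cast.
Qed.

Lemma fnorm_dX_le z : fnorm (dX z) <= fnorm z.
Proof.
rewrite -(@ler_pXn2r _ 2) ?nnegrE ?fnorm_ge0 // sqr_fnorm_blocks.
by rewrite lerDl addr_ge0 ?sqr_ge0.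
Qed.

Lemma fnorm_dS_le z : fnorm (dS z) <= fnorm z.
Proof.
rewrite -(@ler_pXn2r _ 2) ?nnegrE ?fnorm_ge0 // sqr_fnorm_blocks.
by rewrite addrA lerDr addr_ge0 ?sqr_ge0.
Qed.

Lemma jacE (X S : 'M[R]_n) z : X^T = X -> S^T = S ->
  jac P X S *m z =
  col_mx (\col_i inner (conA P i) (dX z))
 (col_mx (svec (\sum_i dY z i 0 *: conA P i + dS z))
         (svec (2^-1 *: (dX z *m S + S *m dX z + (dS z *m X + X *m dS z))))).
Proof.
move=> sX sS.
have castM p q q' (e : q = q') (M : 'M[R]_(p, q)) (w : 'cV[R]_q') :
    castmx (erefl, e) M *m w = M *m castmx (esym e, erefl) w.
  by case: _ / e w => w; rewrite !castmx_id.
rewrite /jac castM -/(splitz z) splitzE !mul_col_mx !mul_row_col !mul0mx.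
rewrite !addr0 !add0r mul1mx calA_svec ?sym_dX // calA_tr -svecD.
rewrite !skronE ?sym_dX ?sym_dS // !trmx1 !mulmx1 !mul1mx sX sS.
by rewrite -scalerDr -svecD svecZ.
Qed.

(* A kernel element has [dS = - mu^-1 S dX S] by injectivity of the Lyapunov
   operator of [X], while the linear equations give [tr (dX dS) = 0]; with
   [S = L^T L] this reads [|L dX L^T| = 0]. *)
Lemma jac_unit (X S : 'M[R]_n) mu : lin_indep P -> psd X -> psd S ->
  X *m S = mu%:M -> 0 < mu -> jac P X S \in unitmx.
Proof.
move=> hfree pX pS XS mu0; have sX := pX.1; have sS := pS.1.
have SX := mulmx_scalarC sX sS XS.
have posX := posdef_central pX sS XS mu0.
have posS := posdef_central pS sX SX mu0.
suff ker0 : forall z : 'cV_(m + (N + N)), jac P X S *m z = 0 -> z = 0.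
  rewrite -unitmx_tr -row_free_unit -kermx_eq0; apply/eqP/row_matrixP => i.
  rewrite row0; apply: trmx_inj; rewrite trmx0; apply: ker0.
  by apply: trmx_inj; rewrite trmx_mul trmxK -row_mul mulmx_ker row0 trmx0.
move=> z; rewrite jacE // => /eqP; rewrite !col_mx_eq0 => /and3P[/eqP h1 /eqP h2 /eqP h3].
have {}h2 : \sum_i dY z i 0 *: conA P i + dS z = 0.
  apply: svec_inj; rewrite ?h2 ?svec0 ?trmx0 //.
  by rewrite linearD /= sym_lin_comb sym_dS.
have {}h3 : dX z *m S + S *m dX z + (dS z *m X + X *m dS z) = 0.
  have : 2^-1 *: (dX z *m S + S *m dX z + (dS z *m X + X *m dS z)) = 0.
    apply: svec_inj; rewrite ?h3 ?svec0 ?trmx0 //.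
    by rewrite trmx_symZ // trmx_symD // trmx_symM // ?sym_dX ?sym_dS.
  by move=> /eqP; rewrite scaler_eq0 invr_eq0 pnatr_eq0 /= => /eqP.
(* [dS z] lies in the span of the constraint matrices, to all of which [dX z] is orthogonal. *)
have ortho : \tr (dX z *m dS z) = 0.
  have -> : dS z = - \sum_i dY z i 0 *: conA P i.
    by apply/eqP; rewrite -addr_eq0 addrC h2.
  rewrite -scaleN1r -scalemxAr mxtraceZ mulmx_sumr.
  rewrite (big_morph _ (@mxtraceD R n) (@mxtrace0 R n)) big1 ?mulr0 // => i _.
  rewrite -scalemxAr mxtraceZ mxtrace_mulC.
  by move: h1 => /colP /(_ i); rewrite !mxE /inner => ->; rewrite mulr0.
have eS : dS z = - mu^-1 *: (S *m dX z *m S).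
  apply/eqP; rewrite -subr_eq0; apply/eqP; apply: (lyapunov_inj posX).
    by rewrite linearB /= linearZ /= !trmx_mul sS sym_dX sym_dS mulmxA.
  rewrite mulmxBl mulmxBr -scalemxAl -scalemxAr -!mulmxA SX !mulmxA XS.
  rewrite mul_mx_scalar mul_scalar_mx -!scalemxAl !scalerA mulNr.
  rewrite mulVf ?gt_eqF // !scaleN1r !opprK -[RHS]h3.
  by rewrite addrACA addrC [S *m _ + _]addrC.
have [L eL] := posdef_ex_factor posS.
have X0 : S *m dX z *m S = 0.
  pose H := L *m dX z *m L^T.
  have : fdot H H = 0.
    rewrite /fdot /H !trmx_mul trmxK sym_dX.
    move: ortho; rewrite eS -scalemxAr mxtraceZ => /eqP.
    rewrite mulf_eq0 oppr_eq0 invr_eq0 gt_eqF //= => /eqP <-.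
    rewrite {1 2}eL !mulmxA mxtrace_mulC !mulmxA.
    by rewrite mxtrace_mulC !mulmxA.
  move=> /fdot_eq0 H0.
  have -> : S *m dX z *m S = L^T *m H *m L by rewrite /H {1 2}eL !mulmxA.
  by rewrite H0 mulmx0 mul0mx.
have dS0 : dS z = 0 by rewrite eS X0 scaler0.
have dX0 : dX z = 0.
  (* By [X S = S X = mu I], the left-hand side is [mu^2 dX z]. *)
  have : X *m (S *m dX z *m S) *m X = 0 by rewrite X0 mulmx0 mul0mx.
  rewrite -!mulmxA SX !mulmxA XS mul_mx_scalar mul_scalar_mx scalerA => /eqP.
  by rewrite scaler_eq0 mulf_eq0 orbb gt_eqF //= => /eqP.
have dY0 : dY z = 0 by apply: lin_comb_eq0 => //; move: h2; rewrite dS0 addr0.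
apply: fnorm_eq0; apply/eqP; rewrite -sqrf_eq0 sqr_fnorm_blocks.
by rewrite dX0 dS0 dY0 !fnorm0 expr0n /= !addr0.
Qed.

Definition quadr (z : 'cV[R]_(m + (N + N))) : 'cV[R]_(m + (N + N)) :=
  col_mx 0 (col_mx 0 (svec (2^-1 *: (dX z *m dS z + dS z *m dX z)))).

Lemma quadr0 : quadr 0 = 0.
Proof.
by rewrite /quadr dX0 mul0mx mulmx0 addr0 scaler0 svec0 !col_mx0.
Qed.

(** Polarisation: the difference is bilinear in [z - z'] and [z + z']. Submultiplicativity leaves
    half of [|U| |V'| + |V| |U'|], and Cauchy-Schwarz in the plane bounds this sum by the product of
    the full norms. *)
Lemma quadr_lip z z' :
  fnorm (quadr z - quadr z') <= 2^-1 * fnorm (z - z') * fnorm (z + z').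
Proof.
set U := dX (z - z'); set V := dS (z - z').
set U' := dX (z + z'); set V' := dS (z + z').
have zE : z = 2^-1 *: ((z - z') + (z + z')).
  by apply/colP => i; rewrite !mxE; field.
have eQ : quadr z - quadr z' = col_mx 0 (col_mx 0 (svec
    (2^-1 *: (2^-1 *: ((U *m V' + V' *m U) + (V *m U' + U' *m V)))))).
  rewrite /quadr !opp_col_mx !add_col_mx !oppr0 !addr0 -svecN -svecD.
  congr (col_mx _ (col_mx _ (svec _))).
  rewrite -scalerBr; congr (_ *: _).
  rewrite /U /V /U' /V' !dXD !dSD !dXN !dSN.
  rewrite !(mulmxDl, mulmxDr, mulNmx, mulmxN).
  by apply/matrixP => i j; rewrite !mxE; field.
have symW : (2^-1 *: (2^-1 *: ((U *m V' + V' *m U) + (V *m U' + U' *m V))))^T =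
    2^-1 *: (2^-1 *: ((U *m V' + V' *m U) + (V *m U' + U' *m V))).
  by rewrite !trmx_symZ // trmx_symD // trmx_symM // ?sym_dX ?sym_dS.
have -> : fnorm (quadr z - quadr z') =
    fnorm (2^-1 *: (2^-1 *: ((U *m V' + V' *m U) + (V *m U' + U' *m V)))).
  have h0 p q k (M : 'M[R]_(p, k)) : fnorm (col_mx (0 : 'M[R]_(q, k)) M) = fnorm M.
    by rewrite !fnormE /fdot tr_col_mx trmx0 mul_row_col mul0mx add0r.
  by rewrite eQ !h0 fnorm_svec.
have hV : `|2^-1 : R| = 2^-1 by rewrite ger0_norm ?invr_ge0.
rewrite !fnormZ !hV -mulrA ler_wpM2l ?invr_ge0 //.
have s1 : fnorm (U *m V' + V' *m U) <= 2 * (fnorm U * fnorm V').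
  apply: (le_trans (fnormD _ _)).
  by have := fnormM U V'; have := fnormM V' U; lra.
have s2 : fnorm (V *m U' + U' *m V) <= 2 * (fnorm V * fnorm U').
  apply: (le_trans (fnormD _ _)).
  by have := fnormM V U'; have := fnormM U' V; lra.
have s3 : fnorm U * fnorm V' + fnorm V * fnorm U' <= fnorm (z - z') * fnorm (z + z').
  rewrite -(@ler_pXn2r _ 2) ?nnegrE ?addr_ge0 ?mulr_ge0 ?fnorm_ge0 //.
  rewrite exprMn !sqr_fnorm_blocks -/U -/V -/U' -/V'.
  have [] := (sqr_ge0 (fnorm (dY (z - z'))), sqr_ge0 (fnorm (dY (z + z')))).
  move: (fnorm (dY (z - z')) ^+ 2) (fnorm (dY (z + z')) ^+ 2) => a b a0 b0.
  move: (fnorm U) (fnorm V) (fnorm U') (fnorm V') => u v u' v'.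
  have h1 := sqr_ge0 (u * u' - v * v').
  have h2 : 0 <= a * (u' ^+ 2 + v' ^+ 2) by rewrite mulr_ge0 ?addr_ge0 ?sqr_ge0.
  have h3 : 0 <= b * (u ^+ 2 + v ^+ 2) by rewrite mulr_ge0 ?addr_ge0 ?sqr_ge0.
  have h4 : 0 <= a * b by rewrite mulr_ge0.
  rewrite -subr_ge0.
  (* Lagrange's identity, with the extra nonnegative terms of the [y] blocks [a] and [b]. *)
  have -> : (u ^+ 2 + (a + v ^+ 2)) * (u' ^+ 2 + (b + v' ^+ 2)) - (u * v' + v * u') ^+ 2
    = (u * u' - v * v') ^+ 2 + a * (u' ^+ 2 + v' ^+ 2) + b * (u ^+ 2 + v ^+ 2) + a * b.
    by ring.
  by rewrite !addr_ge0.
apply: (@le_trans _ _ (2^-1 * (2 * (fnorm U * fnorm V') + 2 * (fnorm V * fnorm U')))).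
  rewrite ler_wpM2l ?invr_ge0 //; apply: (le_trans (fnormD _ _)); exact: lerD.
by rewrite -mulrDr mulrA mulVf ?pnatr_eq0 // mul1r.
Qed.

Definition rhs_dir (e : R) : 'cV[R]_(m + (N + N)) :=
  col_mx 0 (col_mx (svec (e *: dirC P)) 0).

Lemma fnorm_rhs_dirB e e' :
  fnorm (rhs_dir e - rhs_dir e') = `|e - e'| * fnorm (dirC P).
Proof.
rewrite /rhs_dir !opp_col_mx !add_col_mx !subr0 -svecN -svecD -scalerBl.
rewrite -fnormZ -[RHS]fnorm_svec; last by rewrite linearZ /= dirC_sym.
rewrite !fnormE /fdot tr_col_mx mul_row_col mulmx0 add0r.
by rewrite tr_col_mx mul_row_col mulmx0 addr0.
Qed.

(** The equations are quadratic, so their second-order expansion at the central solution is exact.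
    Semidefiniteness is absent from the conclusion; it is the business of the continuation. *)
Lemma newton_root (X S : 'M[R]_n) (y : 'cV[R]_m) mu e z :
  central P 0 mu X y S -> jac P X S *m z = rhs_dir e - quadr z ->
  let Xe := X + dX z in let ye := y + dY z in let Se := S + dS z in
  [/\ Xe^T = Xe, Se^T = Se, forall i, inner (conA P i) Xe = rhs P i 0,
      (\sum_i ye i 0 *: conA P i) + Se = cost P e
    & 2^-1 *: (Xe *m Se + Se *m Xe) = mu%:M].
Proof.
move=> [hA hD XS pX pS] + Xe ye Se; have sX := pX.1; have sS := pS.1.
rewrite jacE // /rhs_dir /quadr !opp_col_mx !add_col_mx !oppr0 !addr0 add0r.
move=> /eq_col_mx [h1 /eq_col_mx [h2 h3]].
have SX := mulmx_scalarC sX sS XS.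
have sXe : Xe^T = Xe by rewrite linearD /= sX sym_dX.
have sSe : Se^T = Se by rewrite linearD /= sS sym_dS.
have {}h2 : \sum_i dY z i 0 *: conA P i + dS z = e *: dirC P.
  apply: svec_inj => //.
    by rewrite linearD /= sym_lin_comb sym_dS.
  by rewrite linearZ /= dirC_sym.
have {}h3 : 2^-1 *: (dX z *m S + S *m dX z + (dS z *m X + X *m dS z)) =
            - (2^-1 *: (dX z *m dS z + dS z *m dX z)).
  apply: svec_inj; rewrite ?svecN //.
    by rewrite trmx_symZ // trmx_symD // trmx_symM // ?sym_dX ?sym_dS.
  by rewrite -scaleNr trmx_symZ // trmx_symM // ?sym_dX ?sym_dS.
split=> //.
- move=> i; rewrite /inner /Xe mulmxDr mxtraceD -/(inner _ X) hA.
  by move: h1 => /colP /(_ i); rewrite !mxE /inner => ->; rewrite addr0.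
- rewrite /ye /Se.
  have -> : \sum_i (y + dY z) i 0 *: conA P i =
      \sum_i y i 0 *: conA P i + \sum_i dY z i 0 *: conA P i.
    by rewrite -big_split; apply: eq_bigr => i _; rewrite mxE scalerDl.
  by rewrite addrACA hD h2 /cost scale0r addr0.
- have -> : Xe *m Se + Se *m Xe = 2 *: mu%:M +
      (dX z *m S + S *m dX z + (dS z *m X + X *m dS z)) +
      (dX z *m dS z + dS z *m dX z).
    rewrite /Xe /Se !(mulmxDl, mulmxDr) XS SX.
    by apply/matrixP => i j; rewrite !mxE; ring.
  rewrite scalerDr [2^-1 *: (2 *: _ + _)]scalerDr h3 addrNK scalerA.
  by rewrite mulVf ?pnatr_eq0 // scale1r.
Qed.

End Jacobian.

(** * Existence of the perturbed central solution *)

Section Continuation.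
Context {R : realType} {n m : nat}.
Variable P : psdo R n m.

(** [rho] is the smaller root of [th / 2 * rho^2 - rho + th * |e| * |dirC| = 0], the equality case
    of the invariance condition in [quadratic_fixpoint]. *)
Lemma central_near mu (X S : 'M[R]_n) (y : 'cV[R]_m) (e : R) :
  let th := theta P X S in
  let rho := (1 - Num.sqrt (1 - 2 * `|e| * th ^+ 2 * fnorm (dirC P))) / th in
  lin_indep P -> 0 < mu -> central P 0 mu X y S -> 0 < th ->
  2 * `|e| * th ^+ 2 * fnorm (dirC P) < 1 ->
  exists Xe ye Se, [/\ central P e mu Xe ye Se,
    fnorm (Xe - X) <= rho & fnorm (Se - S) <= rho].
Proof.
move=> th rho hfree mu0 cen th0 h1.
have [_ _ XS pX pS] := cen; have sX := pX.1; have sS := pS.1.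
have uJ := jac_unit hfree pX pS XS mu0.
pose K := invmx (jac P X S); pose c := fnorm (dirC P).
have c0 : 0 <= c := fnorm_ge0 _.
have Kth v : fnorm (K *m v) <= th * fnorm v := fnorm_mulmx_le K v.
pose h := `|e| * th ^+ 2 * c.
have hE : 2 * `|e| * th ^+ 2 * c = 2 * h by rewrite /h !mulrA.
pose sq := Num.sqrt (1 - 2 * h).
have h0 : 0 <= h by rewrite mulr_ge0 // mulr_ge0 ?sqr_ge0.
have h1' : 2 * h < 1 by rewrite -hE.
have sq_gt0 : 0 < sq by rewrite sqrtr_gt0 subr_gt0.
have sqE : sq ^+ 2 = 1 - 2 * h by rewrite sqr_sqrtr // subr_ge0 ltW.
have sq_le1 : sq <= 1 by rewrite -[leRHS]sqrtr1 ler_wsqrtr // gerBl mulr_ge0.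
have rhoE : rho = (1 - sq) / th by rewrite /rho -/c hE.
have thrho : th * rho = 1 - sq by rewrite rhoE mulrC divfK ?gt_eqF.
have rho0 : 0 <= rho by rewrite rhoE divr_ge0 ?subr_ge0 // ltW.
have lt1 : th * rho < 1 by rewrite thrho gtrBl.
have rhs0 : rhs_dir P 0 = 0 by rewrite /rhs_dir scale0r svec0 !col_mx0.
have nrhs e' : fnorm (rhs_dir P e') = `|e'| * c.
  by have := fnorm_rhs_dirB P e' 0; rewrite rhs0 !subr0.
(* One ball serves every parameter between 0 and [e]. With [th * rho = 1 - sq], invariance reduces
   to [h + (1 - sq)^2 / 2 <= 1 - sq], an equality. *)
have sol e' : `|e'| <= `|e| ->
    exists z, fnorm z <= rho /\ K *m (rhs_dir P e' - quadr z) = z.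
  move=> he'; apply: (quadratic_fixpoint (ltW th0) Kth (@quadr0 _ _ _)
    (@quadr_lip _ _ _)) => //.
  rewrite nrhs -(ler_pM2l th0) mulrDr.
  have -> : th * (th / 2 * rho ^+ 2) = (th * rho) ^+ 2 / 2 by field.
  rewrite thrho sqrrB expr1n mul1r sqE.
  have : th * (th * (`|e'| * c)) <= h.
    rewrite /h; have := ler_wpM2r c0 he' => h'.
    have -> : `|e| * th ^+ 2 * c = th * (th * (`|e| * c)) by ring.
    by rewrite !ler_wpM2l // ltW.
  lra.
have root e' z : K *m (rhs_dir P e' - quadr z) = z ->
    jac P X S *m z = rhs_dir P e' - quadr z.
  by move=> {1}<-; rewrite mulmxA mulmxV // mul1mx.
(* [s] bounds the norm of the [S]-part all along the path, so [k] is a uniform lower bound for the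
   form of the [X]-part. [D] bounds the Lipschitz constant of the root times [|e|], and [M] steps
   make each move shorter than [k]. *)
pose s := fnorm S + rho + 1.
have s0 : 0 < s by rewrite ltr_wpDl // addr_ge0 ?fnorm_ge0.
pose k := mu / s; have k0 : 0 < k by rewrite divr_gt0.
pose D := th * (`|e| * c) / (1 - th * rho).
have D0 : 0 <= D by rewrite divr_ge0 ?mulr_ge0 ?subr_ge0 ?(ltW th0) ?(ltW lt1).
pose M := Num.bound (D / k).
have DM : D / k < M%:R by apply: archi_boundP; rewrite divr_ge0 // ltW.
have M0 : 0 < M%:R :> R by apply: le_lt_trans DM; rewrite divr_ge0 // ltW.
pose ei i : R := e * i%:R / M%:R.
have eiM : ei M = e by rewrite /ei mulfK // gt_eqF.
(* Every root comes from [sol], expanded at the original solution; only positive definiteness is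
   passed from one step to the next. *)
have path i : (i <= M)%N -> exists z, [/\ fnorm z <= rho,
    K *m (rhs_dir P (ei i) - quadr z) = z & posdef (X + dX z)].
  elim: i => [_|i IH iM].
    exists 0; split; first by rewrite fnorm0.
      by rewrite /ei mulr0 mul0r rhs0 quadr0 subrr mulmx0.
    by rewrite dX0 addr0; exact: posdef_central pX sS XS mu0.
  have [z [zr ze posz]] := IH (ltnW iM).
  have [|w [wr we]] := sol (ei i.+1).
    rewrite /ei !normrM normfV !(ger0_norm (ler0n _ _)) -mulrA.
    by rewrite ler_piMr // ler_pdivrMr // mul1r ler_nat.
  exists w; split=> //.
  have [_ sSz _ _ symz] := newton_root cen (root _ _ ze).
  have [sXw _ _ _ _] := newton_root cen (root _ _ we).
  have [XSz _] := central_of_sym posz sSz mu0 symz.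
  have psdz : psd (X + dX z).
    split; first exact: posz.1.
    move=> v; have [->|/posz.2 /ltW //] := eqVneq v 0.
    by rewrite mulmx0 mxE.
  have Sz : fnorm (S + dS z) <= s.
    apply: (le_trans (fnormD _ _)); rewrite /s -addrA lerD2l.
    by apply: (le_trans (fnorm_dS_le z)); rewrite ler_wpDr.
  have dist : fnorm (w - z) <= D / M%:R.
    apply: (le_trans (quadratic_fixpoint_dist (ltW th0) Kth
      (@quadr_lip _ _ _) lt1 wr zr we ze)).
    rewrite fnorm_rhs_dirB /ei -mulrBl -mulrBr -natrB // subSnn mulr1.
    rewrite normrM normfV (ger0_norm (ltW M0)).
    by rewrite le_eqVlt /D -/c; apply/orP; left; apply/eqP; ring.
  have distk : fnorm (w - z) < k.
    by apply: (le_lt_trans dist); rewrite ltr_pdivrMr // mulrC -ltr_pdivrMr.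
  apply: (@posdef_ge _ _ _ (k - fnorm (w - z))) => //; first by rewrite subr_gt0.
  move=> v; have := central_quad_ge v psdz sSz XSz mu0 s0 Sz.
  have -> : X + dX w = (X + dX z) + dX (w - z).
    by rewrite dXD dXN; apply/matrixP => a b; rewrite !mxE; ring.
  rewrite [(_ + dX (w - z)) *m v]mulmxDl fdotDr mulrBl => q1.
  apply: (lerD q1); apply: le_trans (quad_ge _ _).
  by rewrite lerN2 ler_wpM2r ?fdot_ge0 // fnorm_dX_le.
have [z [zr ze posz]] := path M (leqnn M); rewrite eiM in ze.
have [sXz sSz pf df symz] := newton_root cen (root _ _ ze).
have [XSz psdS] := central_of_sym posz sSz mu0 symz.
exists (X + dX z), (y + dY z), (S + dS z); split.
- split=> //; split=> // v; have [->|/posz.2 /ltW //] := eqVneq v 0.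
  by rewrite mulmx0 mxE.
- by rewrite addrAC subrr add0r; apply: le_trans (fnorm_dX_le z) zr.
- by rewrite addrAC subrr add0r; apply: le_trans (fnorm_dS_le z) zr.
Qed.

End Continuation.

(** * Arranged eigenbases and the final bounds *)

Section Arranged.
Context {R : realType} {n nB nT nN : nat}.
Variables (X S : 'M[R]_n).
Variables (QB : 'M[R]_(n, nB)) (QT : 'M[R]_(n, nT)) (QN : 'M[R]_(n, nN)).
Hypothesis H : eigen_arranged X S QB QT QN.

Lemma diag_row_mx k l (M : 'M[R]_n) (A : 'M[R]_(n, k)) (B : 'M[R]_(n, l)) x :
  M *m row_mx A B = row_mx A B *m diag_mx x ->
  M *m A = A *m diag_mx (lsubmx x) /\ M *m B = B *m diag_mx (rsubmx x).
Proof.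
rewrite -{1}[x]hsubmxK diag_mx_row mul_mx_row mul_row_block.
by rewrite !mulmx0 addr0 add0r => /eq_row_mx.
Qed.

Lemma arranged_splitB : exists x1 x2,
  eigen_split X QB (row_mx QT QN) x1 x2 /\
  perm_eq [seq x1 0 i | i : 'I_nB] (take nB (eigvals X)).
Proof.
case: H => h1 h2 [x [s [hX _ hp _]]].
by exists (lsubmx x), (rsubmx x); have [e1 e2] := diag_row_mx hX; split.
Qed.

(** The block of interest comes last, so the orthogonality relations are extracted block by block
    and reassembled in the order [QN], [QB], [QT]. *)
Lemma arranged_splitN : exists x1 x2,
  eigen_split S QN (row_mx QB QT) x1 x2 /\
  perm_eq [seq x1 0 i | i : 'I_nN] (take nN (eigvals S)).
Proof.
case: H => h1 h2 [x [s [_ hS _ hp]]].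
have [eB eTN] := diag_row_mx hS; have [eT eN] := diag_row_mx eTN.
have sp : eigen_split S QB (row_mx QT QN) (lsubmx s) (rsubmx s) by split.
have [BB + + + full] := split_orth sp.
rewrite !tr_row_mx mul_col_row (scalar_mx_block nT nN) => /eq_block_mx [TT TN NT NN].
rewrite mul_mx_row -[0]row_mx0 => /eq_row_mx [BT BN].
rewrite mul_col_mx -[0]col_mx0 => /eq_col_mx [TB NB].
exists (rsubmx (rsubmx s)), (row_mx (lsubmx s) (lsubmx (rsubmx s))).
split=> //; split=> //.
- rewrite !tr_row_mx !mul_col_row mul_mx_row mul_col_mx.
  by rewrite NN NB NT BN TN BB TT BT TB row_mx0 col_mx0 -!scalar_mx_block.
- move: full; rewrite !tr_row_mx !mul_row_col => <-.
  by rewrite addrC addrA.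
- rewrite diag_mx_row mul_mx_row mul_row_block eB eT !mulmx0.
  by rewrite addr0 add0r.
Qed.

End Arranged.

(** Davis-Kahan with [a] and [b] the eigenvalues of [M] on the two sides of the gap; of [M'] only
    the ordering of the blocks enters. *)
Lemma sdist_eigenspace (R : realType) n k l (M M' : 'M[R]_n)
    (Q1 Q1' : 'M[R]_(n, k)) (Q2 Q2' : 'M[R]_(n, l)) x1 x2 x1' x2' (rho : R) :
  let gap := lam k M - lam k.+1 M in
  M^T = M -> M'^T = M' ->
  eigen_split M Q1 Q2 x1 x2 -> eigen_split M' Q1' Q2' x1' x2' ->
  perm_eq [seq x1 0 i | i : 'I_k] (take k (eigvals M)) ->
  perm_eq [seq x1' 0 i | i : 'I_k] (take k (eigvals M')) ->
  fnorm (M' - M) <= rho -> 5 * rho <= gap -> 0 < gap ->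
  sdist (colsp Q1) (colsp Q1') <= 4 * rho / gap.
Proof.
move=> gap sM sM' H H' p p' le_rho rho_gap gap0.
have [hi lo _] := lam_split H p; have [_ _ ord] := lam_split H' p'.
apply: (@le_trans _ _ (4 * fnorm (M' - M) / gap)).
  by apply: (davis_kahan sM sM' H H' hi lo ord) => //; rewrite -/gap; lra.
by rewrite ler_wpM2r ?invr_ge0 ?(ltW gap0) // ler_wpM2l.
Qed.

Theorem theorem4p4 (R : realType) (n m : nat) (P : psdo R n m)
  (hindep : lin_indep P) (hint : interior_point P)
  (I : set R) (hI : nonlinearity_interval P I) (hI0 : I 0)
  (mu : R) (hmu : 0 < mu)
  (X : 'M[R]_n) (y : 'cV[R]_m) (S : 'M[R]_n) (hcentral : central P 0 mu X y S)
  (e : R) (hIe : I e)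
  (t0 : threshold P 0) (te : threshold P e)
  (hthreshold : (mu%:E < Order.min (mu_tilde t0) (mu_tilde te))%E)
  (hbound : `|e| < 1 / (theta P X S * fnorm (dirC P)) *
    Num.min (delta P X S / 2)
   (Num.min (1 / (2 * theta P X S))
   (Num.min ((lam (dimB P 0) X - lam (dimB P 0).+1 X) / 10)
            ((lam (dimN P 0) S - lam (dimN P 0).+1 S) / 10)))) :
  exists (Xe : 'M[R]_n) (ye : 'cV[R]_m) (Se : 'M[R]_n),
    central P e mu Xe ye Se /\
    forall (QB QBe : 'M[R]_(n, dimB P 0)) (QT QTe : 'M[R]_(n, dimT P 0))
           (QN QNe : 'M[R]_(n, dimN P 0)),
      eigen_arranged X S QB QT QN ->
      eigen_arranged Xe Se QBe QTe QNe ->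
      sdist (colsp QB) (colsp QBe) <=
        4 * (1 - Num.sqrt (1 - 2 * `|e| * theta P X S ^+ 2 * fnorm (dirC P))) /
        (theta P X S * (lam (dimB P 0) X - lam (dimB P 0).+1 X))
      /\
      sdist (colsp QN) (colsp QNe) <=
        4 * (1 - Num.sqrt (1 - 2 * `|e| * theta P X S ^+ 2 * fnorm (dirC P))) /
        (theta P X S * (lam (dimN P 0) S - lam (dimN P 0).+1 S)).
Proof.
set th := theta P X S in hbound *; set c := fnorm (dirC P) in hbound *.
set gB := lam (dimB P 0) X - _ in hbound *; set gN := lam (dimN P 0) S - _ in hbound *.
have th_ge0 : 0 <= th := opnorm_ge0 _; have c_ge0 : 0 <= c := fnorm_ge0 _.
(* If the product vanished, its inverse would be 0 by convention and the bound would read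
   [|e| < 0]. *)
have thc : 0 < th * c.
  rewrite lt0r mulr_ge0 // andbT; apply/eqP => e0.
  by move: hbound; rewrite e0 invr0 mulr0 mul0r ltNge normr_ge0.
have th0 : 0 < th.
  by rewrite lt0r th_ge0 andbT; apply: contraTneq thc => ->; rewrite mul0r ltxx.
move: hbound; rewrite mulrC mulrA mulr1 ltr_pdivlMr // !lt_min.
move=> /and4P[_ b2 b3 b4].
(* The term [1 / (2 theta)] of the minimum is exactly positivity of the discriminant. *)
have h1 : 2 * `|e| * th ^+ 2 * c < 1.
  move: b2; rewrite ltr_pdivlMr ?mulr_gt0 //.
  by have -> : `|e| * (th * c) * (2 * th) = 2 * `|e| * th ^+ 2 * c by ring.
have [Xe [ye [Se [cen' nX nS]]]] := central_near hindep hmu hcentral th0 h1.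
exists Xe, ye, Se; split=> // QB QBe QT QTe QN QNe H H'.
have [_ _ _ [sX _] [sS _]] := hcentral; have [_ _ _ [sXe _] [sSe _]] := cen'.
have ec0 : 0 <= `|e| * (th * c) by rewrite mulr_ge0 // ltW.
set rho := (1 - _) / _ in nX nS.
(* From [1 - sqrt (1 - d) <= d]. The divisor 10 in the hypothesis thus gives [5 rho <= gap], and
   [ec0] makes the gaps positive. *)
have rho_le : rho <= 2 * (`|e| * (th * c)).
  rewrite /rho ler_pdivrMr // -/th -/c.
  set d := 2 * `|e| * th ^+ 2 * c in h1 *.
  have -> : 2 * (`|e| * (th * c)) * th = d by rewrite /d; ring.
  have d0 : 0 <= d by rewrite /d -mulrA !mulr_ge0 // sqr_ge0.
  have := sqr_sqrtr (ltW (_ : 0 < 1 - d)); rewrite subr_gt0 => /(_ h1).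
  have : Num.sqrt (1 - d) <= 1 by rewrite -[leRHS]sqrtr1 ler_wsqrtr // gerBl.
  have := sqrtr_ge0 (1 - d); nra.
have bound g : 4 * (1 - Num.sqrt (1 - 2 * `|e| * th ^+ 2 * c)) / (th * g) =
    4 * rho / g.
  by rewrite /rho invfM !mulrA.
rewrite !bound; split.
- have [x1 [x2 [sp p]]] := arranged_splitB H.
  have [x1' [x2' [sp' p']]] := arranged_splitB H'.
  by apply: (sdist_eigenspace sX sXe sp sp' p p' nX); rewrite -/gB; lra.
- have [x1 [x2 [sp p]]] := arranged_splitN H.
  have [x1' [x2' [sp' p']]] := arranged_splitN H'.
  by apply: (sdist_eigenspace sS sSe sp sp' p p' nS); rewrite -/gN; lra.
Qed.
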